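(* For every integer $m\ge2$ there exist a polynomial $\mathbf{K}_m$ on $\mathbb{H}_m$ and a constant $C_m>0$ such that for all $\pi\in\mathbb{H}_m$ and all $1\le p\le\infty$, $$\frac1{C_m}\sqrt[r_m]{\mathbf{K}_m(\pi)}\le K_{m,p}(\pi)\le C_m\sqrt[r_m]{\mathbf{K}_m(\pi)},$$ where $r_m=\deg\mathbf{K}_m$.
   Context: $\mathbb{H}_m$ denotes the space of real homogeneous polynomials of degree $m$ in $(x,y)$ (including $0$) and $\mathbb{P}_{m-1}$ the space of real polynomials in $(x,y)$ of total degree at most $m-1$. For a nondegenerate closed triangle $T\subset\mathbb{R}^2$ of area $|T|$, $I_{m,T}:C^0(T)\to\mathbb{P}_{m-1}$ is the Lagrange interpolation operator: $I_{m,T}v(\gamma)=v(\gamma)$ for all $\gamma\in T$ whose barycentric coordinates all belong to $\{0,\frac1{m-1},\dots,1\}$. Set $e_{m,T}(v)_p:=\|v-I_{m,T}v\|_{L^p(T)}$ and $K_{m,p}(\pi):=\inf_{|T|=1}e_{m,T}(\pi)_p$ for $\pi\in\mathbb{H}_m$ (infimum over all triangles of area $1$). A function $\mathbf{R}:\mathbb{H}_m\to\mathbb{R}$ is called a polynomial on $\mathbb{H}_m$ if there is a real polynomial $P$ in $m+1$ variables with $\mathbf{R}\left(\sum_{i=0}^ma_ix^iy^{m-i}\right)=P(a_0,\dots,a_m)$ for all $(a_0,\dots,a_m)\in\mathbb{R}^{m+1}$; then $\deg\mathbf{R}:=\deg P$. That the $r_m$-th root is well defined (i.e. $r_m\geq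 1$ and $\mathbf{K}_m\ge0$) is part of the assertion. *)

(* Defs.v *)
From HB Require Import structures.
From mathcomp Require Import all_boot all_order all_algebra.
From mathcomp Require Import all_classical all_reals all_analysis.
(* The notations of mpoly clash with those of mathcomp-analysis. *)
From mathcomp Require Import -(notations) mpoly.

Set Implicit Arguments.
Unset Strict Implicit.
Unset Printing Implicit Defensive.

Import Order.TTheory GRing.Theory Num.Theory.
Import numFieldNormedType.Exports.

Local Open Scope classical_set_scope.
Local Open Scope ring_scope.

Definition mpX (R : realType) (n : nat) (i : 'I_n) : mpoly n R :=
  mpolyX R (mnm1 i).

Definition eval2 (R : realType) (q : mpoly 2 R) (z : R * R) : R :=
  meval (fun i : 'I_2 => if i == ord0 then z.1 else z.2) q.

(* The homogeneous polynomials of degree [m] in two variables, including 0. *)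
Notation hpoly R m := (dhomog 2 R m).

Section Forms.
Variables (R : realType) (m : nat).

Definition form_poly (a : 'I_m.+1 -> R) : mpoly 2 R :=
  \sum_(i < m.+1) a i *: (mpX R ord0 ^+ i * mpX R ord_max ^+ (m - i)).

Lemma form_poly_homog (a : 'I_m.+1 -> R) :
  form_poly a \is ishomog1 m (Measure.clone 2 (@mdeg 2) _).
Proof.
apply: rpred_sum => i _; apply: rpredZ.
rewrite -[X in _ \is ishomog1 X _](subnKC (leq_ord i)).
have dX j : mpX R (j : 'I_2) \is ishomog1 1 (Measure.clone 2 (@mdeg 2) _).
  by rewrite dhomogX /= mdeg1.
apply: dhomogM.
- by rewrite -[X in _ \is ishomog1 X _]mul1n; apply: dhomogMn.
- by rewrite -[X in _ \is ishomog1 X _]mul1n; apply: dhomogMn.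
Qed.

Definition form (a : 'I_m.+1 -> R) : hpoly R m := DHomog (form_poly_homog a).

(* [P] is determined by [K] since [R] is infinite, so that the degree of [K] is
   the degree of [P]. *)
Definition polynomial_on_hpoly (K : hpoly R m -> R) (P : mpoly m.+1 R) : Prop :=
  forall a : 'I_m.+1 -> R, K (form a) = meval a P.

End Forms.

(* [msize P] is the total degree of [P] plus one, and [msize 0 = 0]. *)
Definition total_degree (R : realType) (n : nat) (P : mpoly n R) : nat :=
  (msize P).-1.

Section Triangles.
Variable R : realType.

Local Notation plane_measure := (@lebesgue_measure R \x @lebesgue_measure R)%E.

Definition bary_point (T : 'I_3 -> R * R) (l : 'I_3 -> R) : R * R :=
  (\sum_i l i * (T i).1, \sum_i l i * (T i).2).

(* A triangle is represented by its vertices. *)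
Definition tri (T : 'I_3 -> R * R) : set (R * R) :=
  [set z | exists l : 'I_3 -> R,
     [/\ forall i, 0 <= l i, \sum_i l i = 1 & z = bary_point T l]].

Definition nondegenerate (T : 'I_3 -> R * R) : Prop :=
  forall l : 'I_3 -> R,
    \sum_i l i = 0 -> bary_point T l = (0, 0) -> forall i, l i = 0.

Definition area (T : 'I_3 -> R * R) : \bar R := plane_measure (tri T).

Definition lagrange_node (m : nat) (T : 'I_3 -> R * R) : set (R * R) :=
  [set z | exists l : 'I_3 -> R,
     [/\ forall i, exists2 k : nat, (k <= m.-1)%N & l i = k%:R / m.-1%:R,
         \sum_i l i = 1 & z = bary_point T l]].

Definition interpolant (m : nat) (T : 'I_3 -> R * R) (v : R * R -> R)
    (q : mpoly 2 R) : Prop :=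
  (msize q <= m)%N /\ {in lagrange_node m T, forall z, eval2 q z = v z}.

(* For m >= 2 and [T] nondegenerate there is exactly one interpolant; the
   default value 0 is only used in the other cases. *)
Definition interp (m : nat) (T : 'I_3 -> R * R) (v : R * R -> R) : mpoly 2 R :=
  xget 0 (interpolant m T v).

(* The L^p norm on the triangle is that of the extension by 0 to the plane. *)
Definition interp_error (m : nat) (p : \bar R) (T : 'I_3 -> R * R)
    (v : R * R -> R) : \bar R :=
  Lnorm plane_measure p
    (fun z => ((v z - eval2 (interp m T v) z) * \1_(tri T) z)%:E).

Definition shape_function (m : nat) (p : \bar R) (pi : hpoly R m) : \bar R :=
  ereal_inf [set interp_error m p T (eval2 pi) | T in
               [set T : 'I_3 -> R * R | nondegenerate T /\ area T = 1%E]].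

End Triangles.

(* Main.v *)
Require Import Defs.
From HB Require Import structures.
From mathcomp Require Import all_boot all_order all_algebra all_fingroup.
From mathcomp Require Import all_classical all_reals all_analysis.
From mathcomp Require Import measurable_realfun ess_sup_inf.
From mathcomp Require Import -(notations) mpoly.
From mathcomp Require Import complex ring lra zify.

Set Implicit Arguments.
Unset Strict Implicit.
Unset Printing Implicit Defensive.

Import Order.TTheory GRing.Theory Num.Theory.
Import numFieldNormedType.Exports.
Local Open Scope ring_scope.

(** Writing a triangle [T] as the image of the standard one under an affine map
    with linear part [M], the interpolation error of a form [pi] on [T] is, up to
    constants, the size of the coefficients of [pi \o M]: the error on the
    standard triangle is an explicit combination of products of node factors, and
    finite differences recover the coefficients of the form from the error on a
    set of positive measure.  Hence the shape function is equivalent to the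
    infimum of [|pi \o M|] over the [M] of a fixed determinant.  Let
    [pi = prod_i l_i] over the complex numbers.  For a shift [tau] of the indices
    by [m/2], the power sums over the permutations [s] of
    [prod_i bracket (l_(s i)) (l_(s (tau i)))] are polynomials in the
    coefficients of [pi], invariant under substitutions of determinant 1.  If
    they all vanish then [pi] has a linear factor of multiplicity greater than
    [m/2], which is real since its conjugate is a factor of the same
    multiplicity, and the infimum is 0.  The polynomial K is the sum of suitable
    powers of the squared moduli of these invariants; invariance bounds K by the
    infimum, and compactness of the set of unit forms that are almost minimal in
    their orbit gives the converse bound. *)

(** * Binary forms and linear substitutions *)

(** The power sums are polynomials in the coefficients for a concrete reason. Polarization reduces a
    sum over permutations to products prod_j U(l_j) with one and the same binary form U; factoring U
    into linear forms with coefficient vectors w_r and exchanging the two products gives prod_r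
    pi(w_r), a product of values of pi. All powers up to a bound are summed, since the plain sum of
    the bracket products may vanish by cancellation, whereas enough vanishing power sums force every
    single product to vanish. The threshold m/2 is what degeneration requires: diag(t, 1/t)
    multiplies the coefficient of x^i y^(m-i) by t^(2i-m), which is small with t exactly for i >
    m/2. The constants do not depend on p because the triangles have area 1: a supremum bounds every
    norm, and a lower bound c on a set of measure s <= 1 gives c * s^(1/p) >= c * s. An infimum over
    an orbit need not be attained, whence the factor 2 in the choice of almost minimal forms and an
    additive error that tends to 0 at the very end. *)

Section BinaryForms.
Variable A : comNzRingType.
Implicit Types (m : nat) (l e f : A * A) (x y : A).

Definition form_eval m (c : nat -> A) x y : A :=
  \sum_(i < m.+1) c i * x ^+ i * y ^+ (m - i).

(** The linear form at [y = 1]: forms of degree [m] are encoded by univariate polynomials of size at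
    most [m.+1], and a factor with [l.1 = 0] stands for a root at infinity. *)
Definition linpoly l : {poly A} := l.1 *: 'X + l.2%:P.

Definition lineval l x y := l.1 * x + l.2 * y.

Definition bracket l l' := l.1 * l'.2 - l.2 * l'.1.

Lemma size_linpoly l : (size (linpoly l) <= 2)%N.
Proof.
rewrite (leq_trans (size_polyD _ _))// geq_max (leq_trans (size_scale_leq _ _)) ?size_polyX//=.
exact: (leq_trans (size_polyC_leq1 _)).
Qed.

Lemma size_prod_linpoly m (l : 'I_m -> A * A) :
  (size (\prod_i linpoly (l i))%R <= m.+1)%N.
Proof.
elim: m l => [|m IH] l; first by rewrite big_ord0 size_poly1.
rewrite big_ord_recr/= (leq_trans (size_polyMleq _ _))//.
by rewrite -subn1 leq_subLR add1n -(addn2 m.+1) leq_add ?IH ?size_linpoly.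
Qed.

Lemma form_eval_ext m c c' x y : (forall i, (i <= m)%N -> c i = c' i) ->
  form_eval m c x y = form_eval m c' x y.
Proof. by move=> cc; apply: eq_bigr => i _; rewrite cc// -ltnS. Qed.

Lemma form_eval_mul_linpoly m (p : {poly A}) l x y : (size p <= m.+1)%N ->
  form_eval m.+1 (fun i => (p * linpoly l)`_i) x y =
  form_eval m (fun i => p`_i) x y * lineval l x y.
Proof.
move=> sp; rewrite /form_eval /linpoly /lineval.
transitivity (\sum_(i < m.+2) (p * 'X)`_i * l.1 * x ^+ i * y ^+ (m.+1 - i) +
   \sum_(i < m.+2) p`_i * l.2 * x ^+ i * y ^+ (m.+1 - i)).
  rewrite -big_split/=; apply: eq_bigr => i _.
  by rewrite mulrDr coefD -scalerAr coefZ coefMC; ring.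
rewrite mulrDr !mulr_suml; congr (_ + _).
  rewrite big_ord_recl/= coefMX/= !mul0r add0r; apply: eq_bigr => i _.
  by rewrite coefMX/= /bump/= add1n subSS exprS; ring.
rewrite big_ord_recr/= (nth_default _ sp) !mul0r addr0; apply: eq_bigr => i _.
by rewrite subSn -1?ltnS// exprS; ring.
Qed.

Lemma form_eval_prod m (l : 'I_m -> A * A) x y :
  form_eval m (fun i => (\prod_j linpoly (l j))`_i) x y = \prod_j lineval (l j) x y.
Proof.
elim: m l => [|m IH] l.
  by rewrite /form_eval big_ord_recl !big_ord0 coef1/= !mulr1 addr0.
rewrite big_ord_recr/= form_eval_mul_linpoly; last exact: size_prod_linpoly.
by rewrite IH big_ord_recr.
Qed.

Lemma linpoly_prod_form_eval m (l : 'I_m -> A * A) (p : {poly A}) x y :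
  p = \prod_j linpoly (l j) -> form_eval m (fun i => p`_i) x y = \prod_j lineval (l j) x y.
Proof. by move=> ->; exact: form_eval_prod. Qed.

End BinaryForms.

Section Action.
Variable A : comNzRingType.
Implicit Types (m : nat) (e f : A * A) (c : nat -> A).

(** [e] and [f] are the columns of the substitution matrix. Evaluating the form at polynomial
    arguments yields all the new coefficients at once. *)
Definition coef_subst m e f c : {poly A} :=
  form_eval m (fun i => (c i)%:P) (linpoly (e.1, f.1)) (linpoly (e.2, f.2)).

Lemma prod_ord_split (B : comNzRingType) m k (x y : B) : (k <= m)%N ->
  \prod_(i < m) (if (i < k)%N then x else y) = x ^+ k * y ^+ (m - k).
Proof.
move=> km; rewrite -(big_mkord predT (fun i => if (i < k)%N then x else y)).
rewrite (big_cat_nat (n := k))//=; congr (_ * _).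
  rewrite (@eq_big_nat _ _ _ _ _ _ (fun=> x)); last by move=> i /andP[_ ->].
  by rewrite prodr_const_nat subn0.
rewrite (@eq_big_nat _ _ _ _ _ _ (fun=> y)); last first.
  by move=> i /andP[ki _]; rewrite ltnNge ki.
by rewrite prodr_const_nat.
Qed.

Lemma linpoly_exp_prod m k (l l' : A * A) : (k <= m)%N ->
  linpoly l ^+ k * linpoly l' ^+ (m - k) =
  \prod_(i < m) linpoly (if (i < k)%N then l else l').
Proof. by move=> km; rewrite -prod_ord_split//; apply: eq_bigr => i _; case: ifP. Qed.

Lemma size_coef_subst m e f c : (size (coef_subst m e f c) <= m.+1)%N.
Proof.
rewrite /coef_subst /form_eval; apply: (leq_trans (size_sum _ _ _)).
apply/bigmax_leqP => i _; rewrite -mulrA linpoly_exp_prod; last by rewrite -ltnS.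
by rewrite mul_polyC (leq_trans (size_scale_leq _ _))// size_prod_linpoly.
Qed.

Lemma map_linpoly (B : comNzRingType) (g : {rmorphism A -> B}) (l : A * A) :
  map_poly g (linpoly l) = linpoly (g l.1, g l.2).
Proof. by rewrite /linpoly rmorphD/= map_polyZ/= map_polyX map_polyC. Qed.

(** The morphism [g] serves to compose substitutions: with [g = polyC] the substituted form is
    itself evaluated at points of the polynomial ring. *)
Lemma form_eval_coef_subst (B : comNzRingType) (g : {rmorphism A -> B}) m e f c (x y : B) :
  form_eval m (fun i => g (coef_subst m e f c)`_i) x y =
  form_eval m (fun i => g (c i)) (lineval (g e.1, g f.1) x y) (lineval (g e.2, g f.2) x y).
Proof.
rewrite /coef_subst.
pose q (k : 'I_m.+1) := linpoly (e.1, f.1) ^+ k * linpoly (e.2, f.2) ^+ (m - k).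
transitivity (\sum_(k < m.+1) g (c k) * form_eval m (fun i => (map_poly g (q k))`_i) x y).
  rewrite /form_eval; under [RHS]eq_bigr do rewrite mulr_sumr.
  rewrite exchange_big/=; apply: eq_bigr => i _.
  rewrite coef_sum rmorph_sum !mulr_suml; apply: eq_bigr => k _.
  by rewrite coef_map/= -[in LHS](mulrA (c k)%:P) mul_polyC coefZ rmorphM !mulrA.
apply: eq_bigr => k _; rewrite -mulrA; congr (_ * _).
have km : (k <= m)%N by rewrite -ltnS.
rewrite /q linpoly_exp_prod// rmorph_prod/=.
under eq_bigr do rewrite map_linpoly.
rewrite form_eval_prod -prod_ord_split//; apply: eq_bigr => i _.
by case: ifP.
Qed.

Lemma form_eval_coef_substE m e f c (x y : A) :
  form_eval m (fun i => (coef_subst m e f c)`_i) x y =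
  form_eval m c (lineval (e.1, f.1) x y) (lineval (e.2, f.2) x y).
Proof. exact: (form_eval_coef_subst idfun). Qed.

Lemma coef_subst_coef_subst m e f e' f' c :
  coef_subst m e' f' (fun i => (coef_subst m e f c)`_i) =
  coef_subst m (e.1 * e'.1 + f.1 * e'.2, e.2 * e'.1 + f.2 * e'.2)
        (e.1 * f'.1 + f.1 * f'.2, e.2 * f'.1 + f.2 * f'.2) c.
Proof.
rewrite {1}/coef_subst (form_eval_coef_subst (polyC : {rmorphism _ -> _})) /coef_subst /=.
by congr form_eval; rewrite /lineval /linpoly/= !polyCD !polyCM -!mul_polyC ?polyCD ?polyCM; ring.
Qed.

Lemma coef_subst_prod m e f (l : 'I_m -> A * A) :
  coef_subst m e f (fun i => (\prod_j linpoly (l j))`_i) =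
  \prod_j linpoly (lineval (l j) e.1 e.2, lineval (l j) f.1 f.2).
Proof.
rewrite /coef_subst.
transitivity (form_eval m (fun i => (\prod_j linpoly ((l j).1%:P, (l j).2%:P))`_i)
  (linpoly (e.1, f.1)) (linpoly (e.2, f.2))).
  apply: form_eval_ext => i _; rewrite -coef_map/= rmorph_prod/=.
  by under eq_bigr do rewrite map_linpoly.
rewrite form_eval_prod; apply: eq_bigr => j _.
by rewrite /lineval /linpoly/= -!mul_polyC !polyCD !polyCM; ring.
Qed.

End Action.

(** A drop of the degree is compensated by constant factors [(0, 1)], that is, by roots at infinity,
    so that the number of factors never depends on the size of [p]; the base case absorbs
    [p = 0]. *)
Lemma linpoly_factor (F : closedFieldType) m (p : {poly F}) : (size p <= m.+2)%N ->
  exists l : 'I_m.+1 -> F * F, p = \prod_i linpoly (l i).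
Proof.
elim: m p => [|m IH] p sp.
  exists (fun=> (p`_1, p`_0)); rewrite big_ord_recl big_ord0 mulr1 /linpoly/=.
  apply/polyP => -[|[|i]]; rewrite coefD coefZ coefX coefC/= ?mulr0 ?mulr1 ?add0r ?addr0//.
  by rewrite nth_default// (leq_trans sp).
have [sp'|sp'] := leqP (size p) m.+2.
  have [l pl] := IH _ sp'.
  exists (fun i => if unlift ord0 i is Some j then l j else (0, 1)).
  rewrite big_ord_recl unlift_none pl /linpoly/= scale0r add0r mul1r.
  by apply: eq_bigr => i _; rewrite liftK.
have /closed_rootP[z pz] : size p != 1%N by rewrite gtn_eqF// (leq_trans _ sp').
have /factor_theorem[q pq] := pz.
have q0 : q != 0 by apply: contraTneq sp' => q0; rewrite pq q0 mul0r size_poly0.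
have sq : (size q <= m.+2)%N.
  by move: sp; rewrite pq size_Mmonic ?monicXsubC// size_XsubC addn2.
have [l ql] := IH _ sq.
exists (fun i => if unlift ord0 i is Some j then l j else (1, - z)).
rewrite big_ord_recl unlift_none pq ql /linpoly/= scale1r polyCN mulrC; congr (_ * _).
by apply: eq_bigr => i _; rewrite liftK.
Qed.

(** * Invariants of binary forms *)

Section Polarization.
Variable A : comNzRingType.

Lemma prod_bool (I : finType) (b : pred I) :
  \prod_i (b i)%:R = [forall i, b i]%:R :> A.
Proof.
case: forallP => [ball|/forallP].
  by rewrite big1// => i _; rewrite ball.
by rewrite negb_forall => /existsP[i bi]; rewrite (bigD1 i)//= (negPf bi) mul0r.
Qed.

(* In the expansion of the right-hand side, inclusion-exclusion over the sign
   vectors [eps] kills the terms of the non-surjective maps. *)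
Lemma permanent_polarization m (T : Type) (g : 'I_m -> T -> A) (x : 'I_m -> T) :
  \sum_(s : 'S_m) \prod_i g i (x (s i)) =
  \sum_(eps : {ffun 'I_m -> bool}) (\prod_i (-1) ^+ (~~ eps i)) *
    \prod_j (\sum_i (eps i)%:R * g i (x j)).
Proof.
under [RHS]eq_bigr do rewrite bigA_distr_bigA mulr_sumr/=.
rewrite exchange_big/=.
transitivity (\sum_(f : {ffun 'I_m -> 'I_m})
   (injectiveb f)%:R * \prod_j g (f j) (x j)); last first.
  apply: eq_bigr => f _.
  under [RHS]eq_bigr do rewrite big_split/= mulrA.
  rewrite -mulr_suml; congr (_ * _).
  transitivity (\sum_(eps : {ffun 'I_m -> bool})
    \prod_i ((-1) ^+ (~~ eps i) * ((i \in codom f) ==> eps i)%:R : A)); last first.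
    apply: eq_bigr => eps _; rewrite big_split/=; congr (_ * _).
    rewrite !prod_bool; congr (nat_of_bool _)%:R; apply/forallP/forallP.
      by move=> h j; move/implyP: (h (f j)); apply; exact: codom_f.
    by move=> h i; apply/implyP => /codomP[j ->].
  rewrite -(bigA_distr_bigA (fun i b => (-1) ^+ (~~ b) * ((i \in codom f) ==> b)%:R : A)).
  under eq_bigr => i _.
    rewrite (_ : \sum_j _ = (i \in codom f)%:R); first over.
    by rewrite big_bool/= implybT implybF; case: (_ \in _); rewrite /= ?expr0 ?expr1; ring.
  rewrite prod_bool; congr (nat_of_bool _)%:R.
  apply/injectiveP/forallP => [finj i|fsurj].
    by have [h _ fK] := injF_bij finj; rewrite -(fK i) codom_f.
  apply/injectiveP; rewrite /injectiveb /dinjectiveb.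
  apply/card_uniqP; rewrite size_map -cardE.
  by apply: eq_card => i; rewrite fsurj.
rewrite (bigID (fun f : {ffun _} => injectiveb f))/= [X in _ = _ + X]big1 ?addr0; last first.
  by move=> f /negPf ->; rewrite mul0r.
rewrite [RHS](eq_bigr (fun f : {ffun 'I_m -> 'I_m} => \prod_j g (f j) (x j))); last first.
  by move=> f ->; rewrite mul1r.
rewrite [RHS](reindex (@pval _))/=; last first.
  pose in_Sn := insubd (1%g : 'S_m).
  by exists in_Sn => f /= Uf; first apply: val_inj; apply: insubdK.
rewrite (reindex_inj invg_inj)/=; apply: eq_big => s; first by rewrite (valP s).
move=> _; rewrite (reindex_inj (@perm_inj _ s)); apply: eq_bigr => i _.
by rewrite permK pvalE.
Qed.

Definition coord (b : bool) (l : A * A) := if b then l.1 else l.2.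

(** Each bracket is a signed sum of two terms, selected by a boolean, and the product is regrouped
    by points: [x j] occurs in the brackets of index [j] and [tau^-1 j], hence with [2 * k]
    coordinates. Each summand is thus a product over [j] of forms of degree [2 * k] in [x j], the
    shape that polarization asks for. *)
Lemma prod_bracket_expand m k (tau : 'S_m) (x : 'I_m -> A * A) :
  (\prod_i bracket (x i) (x (tau i))) ^+ k =
  \sum_(f : {ffun 'I_m * 'I_k -> bool}) (\prod_i (-1) ^+ (~~ f i)) *
   \prod_j ((\prod_r coord (f (j, r)) (x j)) *
            (\prod_r coord (~~ f (tau^-1%g j, r)) (x j))).
Proof.
transitivity (\prod_(i : 'I_m * 'I_k) \sum_(b : bool)
   ((-1) ^+ (~~ b) * (coord b (x i.1) * coord (~~ b) (x (tau i.1))))).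
  rewrite -(pair_bigA _ (fun i r => \sum_(b : bool)
    ((-1) ^+ (~~ b) * (coord b (x i) * coord (~~ b) (x (tau i))))))/=.
  rewrite -prodrXl; apply: eq_bigr => i _; rewrite prodr_const card_ord.
  by congr (_ ^+ _); rewrite big_bool/= /bracket; ring.
rewrite bigA_distr_bigA/=; apply: eq_bigr => f _.
rewrite big_split/=; congr (_ * _); rewrite !big_split/=; congr (_ * _).
  by rewrite (pair_bigA _ (fun i r => coord (f (i, r)) (x i))); apply: eq_bigr => -[].
rewrite [RHS](reindex_inj (@perm_inj _ tau))/=.
rewrite (eq_bigr (fun i => coord (~~ f (i.1, i.2)) (x (tau i.1)))); last by case.
rewrite -(pair_bigA _ (fun i r => coord (~~ f (i, r)) (x (tau i))))/=.
by apply: eq_bigr => i _; apply: eq_bigr => r _; rewrite permK.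
Qed.

Definition isform d (g : A * A -> A) :=
  exists2 p : {poly A}, (size p <= d.+1)%N &
    forall l, g l = form_eval d (fun i => p`_i) l.1 l.2.

Lemma isform_sum d (I : finType) (c : I -> A) (g : I -> A * A -> A) :
  (forall i, isform d (g i)) -> isform d (fun l => \sum_i c i * g i l).
Proof.
move=> gf; have /fin_all_exists2[p sp gp] := gf.
exists (\sum_i c i *: p i).
  apply: (leq_trans (size_sum _ _ _)); apply/bigmax_leqP => i _.
  exact: leq_trans (size_scale_leq _ _) (sp i).
move=> l; under eq_bigr do rewrite gp /form_eval mulr_sumr.
rewrite exchange_big/=; apply: eq_bigr => j _.
rewrite coef_sum !mulr_suml; apply: eq_bigr => i _.
by rewrite coefZ; ring.
Qed.

Lemma isform_coord d (g : A * A -> A) b :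
  isform d g -> isform d.+1 (fun l => g l * coord b l).
Proof.
move=> [p sp gp]; pose e : A * A := if b then (1, 0) else (0, 1).
exists (p * linpoly e).
  rewrite (leq_trans (size_polyMleq _ _))// -subn1 leq_subLR add1n -(addn2 d.+1).
  by rewrite leq_add ?size_linpoly.
move=> l; rewrite form_eval_mul_linpoly// -gp; congr (_ * _).
by rewrite /e /lineval; case: (b); rewrite /= mul0r mul1r ?addr0 ?add0r.
Qed.

Lemma isform_prod_coord d (g : A * A -> A) k (b : 'I_k -> bool) :
  isform d g -> isform (d + k) (fun l => g l * \prod_r coord (b r) l).
Proof.
elim: k b => [|k IH] b gf.
  by rewrite addn0; case: gf => p sp gp; exists p => // l; rewrite big_ord0 mulr1.
rewrite addnS.
have [p sp gp] := isform_coord (b ord_max) (IH (fun i => b (widen_ord (leqnSn k) i)) gf).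
by exists p => // l; rewrite -gp big_ord_recr/= mulrA.
Qed.

End Polarization.

Notation homog d P := (P \is ishomog1 d (Measure.clone _ (@mdeg _) _)).

Section Invariants.
Variables (R : rcfType) (m : nat).
Local Notation C := R[i].
Implicit Types (a : 'rV[R]_m.+1) (l : 'I_m -> C * C) (F : ('I_m -> C * C) -> C).

Definition factored a l := map_poly (real_complex R) (rVpoly a) = \prod_i linpoly (l i).

(** The independence meant here is that of the chosen factorization: [F] descends to a function of
    the coefficients, homogeneous of degree [d]. Real and imaginary parts are kept apart because the
    final polynomial has to be real. *)
Definition invariant d F := exists P1 P2 : mpoly m.+1 R,
  [/\ homog d P1, homog d P2 & forall a l, factored a l ->
    F l = (meval (a 0) P1 +i* meval (a 0) P2)%C].

Lemma invariant_ext d F G : F =1 G -> invariant d F -> invariant d G.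
Proof. by move=> FG [P1 [P2 [? ? e]]]; exists P1, P2; split => // a l al; rewrite -FG (e a). Qed.

Lemma invariantD d F G : invariant d F -> invariant d G ->
  invariant d (fun l => F l + G l).
Proof.
move=> [P1 [P2 [h1 h2 e]]] [Q1 [Q2 [k1 k2 e']]].
exists (P1 + Q1), (P2 + Q2); split; [exact: rpredD|exact: rpredD|].
by move=> a l al; rewrite (e a)// (e' a)// !mevalD.
Qed.

Lemma invariantM d e F G : invariant d F -> invariant e G ->
  invariant (d + e) (fun l => F l * G l).
Proof.
move=> [P1 [P2 [h1 h2 E]]] [Q1 [Q2 [k1 k2 E']]].
exists (P1 * Q1 - P2 * Q2), (P1 * Q2 + P2 * Q1); split.
- by apply: rpredB; exact: dhomogM.
- by apply: rpredD; exact: dhomogM.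
by move=> a l al; rewrite (E a)// (E' a)// mevalB mevalD !mevalM.
Qed.

Lemma invariant_cst c : invariant 0 (fun=> c).
Proof.
exists (mpolyC _ (complex.Re c)), (mpolyC _ (complex.Im c)).
have hC (r : R) : homog 0 (mpolyC m.+1 r).
  by rewrite -[mpolyC _ r]mulr1 mul_mpolyC; apply: rpredZ; exact: dhomog1.
by split => // a l _; rewrite !mevalC; case: c.
Qed.

Lemma invariant_sum d (I : finType) (F : I -> ('I_m -> C * C) -> C) :
  (forall i, invariant d (F i)) -> invariant d (fun l => \sum_i F i l).
Proof.
move=> h; elim: (index_enum I) => [|i s IH].
  exists 0, 0; split; [exact: rpred0|exact: rpred0|].
  by move=> a l _; rewrite big_nil meval0.
apply: invariant_ext (invariantD (h i) IH) => l.
by rewrite big_cons.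
Qed.

Lemma invariant_prod (d : nat) (F : 'I_d -> ('I_m -> C * C) -> C) :
  (forall i, invariant 1 (F i)) -> invariant d (fun l => \prod_i F i l).
Proof.
elim: d F => [|d IH] F h.
  by apply: invariant_ext (invariant_cst 1) => l; rewrite big_ord0.
have hF : invariant (1 + d) (fun l => F ord0 l * \prod_i F (lift ord0 i) l).
  by apply: invariantM; [exact: h|apply: IH => i; exact: h].
by apply: invariant_ext hF => l; rewrite big_ord_recl.
Qed.

(** The product is the value of the form at the point [w], which is linear in the coefficients. *)
Lemma invariant_lin (w : C * C) :
  invariant 1 (fun l => \prod_j lineval w (l j).1 (l j).2).
Proof.
pose c (i : 'I_m.+1) := w.1 ^+ i * w.2 ^+ (m - i).
pose X (i : 'I_m.+1) : mpoly m.+1 R := mpolyX R (mnm1 i).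
have hX (b : 'I_m.+1 -> R) : homog 1 (\sum_i b i *: X i).
  by apply: rpred_sum => i _; apply: rpredZ; rewrite dhomogX /= mdeg1.
exists (\sum_i complex.Re (c i) *: X i), (\sum_i complex.Im (c i) *: X i); split => //.
move=> a l al.
transitivity (form_eval m (fun i => (map_poly (real_complex R) (rVpoly a))`_i) w.1 w.2).
  rewrite al form_eval_prod; apply: eq_bigr => j _; rewrite /lineval; ring.
rewrite !raddf_sum/=.
under [X in (X +i* _)%C]eq_bigr do rewrite mevalZ mevalXU.
under [X in (_ +i* X)%C]eq_bigr do rewrite mevalZ mevalXU.
rewrite (_ : (_ +i* _)%C = \sum_i (complex.Re (c i) * a 0 i +i* (complex.Im (c i) * a 0 i))%C); last first.
  apply/eqP; rewrite eq_complex !raddf_sum/=.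
  by apply/andP; split; apply/eqP.
apply: eq_bigr => i _; rewrite coef_map/= coef_rVpoly_ord -mulrA -/(c i).
case: (c i) => u v; apply/eqP; rewrite eq_complex/=.
by apply/andP; split; apply/eqP; ring.
Qed.

(** Over the algebraically closed [C], [U] splits into linear forms [w r]; after exchanging the two
    products each [w r] contributes one value of the form, so that the degree in the coefficients is
    the degree of [U]. *)
Lemma invariant_form d (U : C * C -> C) : isform d.+1 U ->
  invariant d.+1 (fun l => \prod_j U (l j)).
Proof.
move=> [p sp Up]; have [w pw] := linpoly_factor sp.
apply: invariant_ext (invariant_prod (fun r => invariant_lin (w r))) => l.
rewrite exchange_big/=; apply: eq_bigr => j _.
by rewrite Up (linpoly_prod_form_eval _ _ pw).
Qed.

Lemma invariant_sum_perm d (g : 'I_m -> C * C -> C) :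
  (forall i, isform d.+1 (g i)) ->
  invariant d.+1 (fun l => \sum_(s : 'S_m) \prod_i g i (l (s i))).
Proof.
move=> gf; apply: (invariant_ext (F := fun l => \sum_(eps : {ffun 'I_m -> bool})
    (\prod_i (-1) ^+ (~~ eps i)) * \prod_j (\sum_i (eps i)%:R * g i (l j)))).
  by move=> l; rewrite (permanent_polarization g l).
apply: invariant_sum => eps; rewrite -[d.+1]add0n.
apply: invariantM; first exact: invariant_cst.
apply: (invariant_form (U := fun x => \sum_i (eps i)%:R * g i x)).
exact: isform_sum.
Qed.

Definition power_sum (tau : 'S_m) k l : C :=
  \sum_(s : 'S_m) (\prod_i bracket (l (s i)) (l (s (tau i)))) ^+ k.

(** Every factor enters two brackets, each to the power [k.+1]: this explains the degree. *)
Lemma invariant_power_sum tau k : invariant (k.+1 + k.+1) (power_sum tau k.+1).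
Proof.
pose g (f : {ffun 'I_m * 'I_k.+1 -> bool}) j (x : C * C) :=
  (\prod_r coord (f (j, r)) x) * (\prod_r coord (~~ f ((tau^-1)%g j, r)) x).
suff H : invariant (k.+1 + k.+1) (fun l =>
    \sum_(f : {ffun 'I_m * 'I_k.+1 -> bool}) (\prod_i (-1) ^+ (~~ f i)) *
    \sum_(s : 'S_m) \prod_j g f j (l (s j))).
  apply: invariant_ext H => l.
  under eq_bigr do rewrite mulr_sumr.
  rewrite exchange_big; apply: eq_bigr => s _.
  by rewrite (prod_bracket_expand _ _ (fun i => l (s i))).
apply: invariant_sum => f; rewrite -[(_ + _)%N]add0n addSn.
apply: invariantM; first exact: invariant_cst.
apply: (invariant_sum_perm (g := g f)).
move=> j; rewrite -addSn; apply: isform_prod_coord.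
have f0 : isform 0 (fun _ : C * C => 1).
  by exists 1; rewrite ?size_poly1// => l; rewrite /form_eval big_ord_recl big_ord0 coef1 !mulr1 addr0.
have [p sp e] := isform_prod_coord (fun r : 'I_k.+1 => f (j, r)) f0.
by exists p => // l; rewrite -e mul1r.
Qed.

End Invariants.

(** * Forms annihilated by all invariants *)

(** If [z i0] were nonzero, take [f] vanishing at 0 and at all values of [z] other than [z i0]. The
    sum of the [f.[z i]] is a combination of power sums, hence 0, but it is also a positive multiple
    of [f.[z i0]], nonzero in characteristic 0. The degree of [f] is at most [#|I| + 1], whence the
    range of [k]. *)
Lemma power_sums_eq0 (F : numFieldType) (I : finType) (z : I -> F) :
  (forall k, (k <= #|I|)%N -> \sum_i z i ^+ k.+1 = 0) -> forall i, z i = 0.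
Proof.
move=> h i0; apply/eqP/negPn/negP => zi0.
pose s := [seq w <- undup (map z (enum I)) | w != z i0].
pose f := 'X * \prod_(w <- s) ('X - w%:P).
have szf : (size f <= #|I|.+2)%N.
  rewrite (leq_trans (size_polyMleq _ _))// size_polyX size_prod_XsubC/= ltnS.
  rewrite ltnS size_filter (leq_trans (count_size _ _))//.
  by rewrite (leq_trans (size_undup _))// size_map -cardE.
have fE i : z i != z i0 -> f.[z i] = 0.
  move=> zi; apply/eqP; rewrite -/(root f (z i)) rootM root_prod_XsubC.
  by rewrite mem_filter zi mem_undup map_f ?mem_enum ?orbT.
have fi0 : f.[z i0] != 0.
  rewrite -/(root f (z i0)) rootM root_prod_XsubC mem_filter eqxx/= orbF.
  by rewrite /root hornerX.
have S0 : \sum_i f.[z i] = 0.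
  under eq_bigr do rewrite (horner_coef_wide _ szf).
  rewrite exchange_big big_ord_recl/= big1 => [|i _]; last first.
    by rewrite /f coefXM mul0r.
  rewrite add0r big1// => k _.
  by rewrite -mulr_sumr /= /bump/= add1n h ?mulr0// -ltnS.
have : \sum_i f.[z i] = #|[pred i | z i == z i0]|%:R * f.[z i0].
  rewrite (bigID (fun i => z i == z i0))/= [X in _ + X]big1 ?addr0 => [|i]; last exact: fE.
  rewrite (eq_bigr (fun=> f.[z i0])) => [|i /eqP -> //].
  by rewrite sumr_const mulr_natl.
rewrite S0 => /esym/eqP; rewrite mulf_eq0 (negPf fi0) orbF pnatr_eq0.
by move/eqP/card0_eq/(_ i0); rewrite inE eqxx.
Qed.

(** * A majority class among the linear factors *)

Section Shift.
Variables (m : nat) (hm : (2 <= m)%N).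

Lemma shift_subproof (i : 'I_m) : ((i + m./2) %% m < m)%N.
Proof. by rewrite ltn_pmod// (leq_trans _ hm). Qed.

Definition shift_fun (i : 'I_m) : 'I_m := Ordinal (shift_subproof i).

Lemma shift_funE (i : 'I_m) :
  shift_fun i = (if i + m./2 < m then i + m./2 else i + m./2 - m)%N :> nat.
Proof.
have im := ltn_ord i; rewrite /=; case: ltnP => h; first by rewrite modn_small.
rewrite -{1}(subnK h) modnDr modn_small//.
by rewrite ltn_subLR// (leq_trans (_ : _ < m + m./2)%N) ?ltn_add2r// leq_add2l; lia.
Qed.

Lemma shift_fun_inj : injective shift_fun.
Proof.
move=> i j ij; have := shift_funE i; rewrite ij shift_funE => h.
apply: val_inj => /=; have := ltn_ord i; have := ltn_ord j; move: h.
by do 2 case: ltnP => ?; lia.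
Qed.

Definition half_shift : 'S_m := perm shift_fun_inj.

Lemma half_shift_neq i : half_shift i != i.
Proof.
rewrite permE; apply/eqP => h; have := shift_funE i; rewrite h => {h}; have im := ltn_ord i.
by case: ltnP => ?; lia.
Qed.

(** The distance is [m./2] if the shift does not wrap around and [m - m./2], which is at least as
    large, if it does. *)
Lemma half_shift_gap (i : 'I_m) (j := half_shift i) :
  (minn i j + m./2 <= maxn i j)%N.
Proof.
rewrite /j permE shift_funE; have im := ltn_ord i.
by case: ltnP => ?; lia.
Qed.

(* Listing the indices by increasing key, two entries at cyclic distance
   [m./2] with the same key enclose more than [m / 2] entries with that key. *)
Lemma majority_key (key : 'I_m -> nat) :
  (forall s : 'S_m, exists i, key (s i) = key (s (half_shift i))) ->
  exists v, (m < 2 * #|[set i | key i == v]|)%N.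
Proof.
move=> h.
pose le := relpre key leq.
have le_total : total le by move=> i j; exact: leq_total.
have le_trans : transitive le by move=> i j k; exact: leq_trans.
pose sq := sort le (enum 'I_m).
have szq : size sq = m by rewrite size_sort size_enum_ord.
have uq : uniq sq by rewrite sort_uniq enum_uniq.
pose sf (i : 'I_m) := nth i sq i.
have sf_inj : injective sf.
  move=> i j /eqP; rewrite /sf (set_nth_default i)// ?szq//.
  by rewrite nth_uniq ?szq// => /eqP/val_inj.
have mono (i j : 'I_m) : (i <= j)%N -> (key (sf i) <= key (sf j))%N.
  move=> ij; rewrite /sf (set_nth_default i j) ?szq//.
  apply: (sorted_leq_nth le_trans (fun i => leqnn (key i)) i (sort_sorted le_total _)) => //;
  by rewrite inE szq.
have [ i ] := h (perm sf_inj); rewrite !permE.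
set j := shift_fun i => keyij.
have hgap := half_shift_gap i; rewrite permE -/j in hgap.
pose p := if (i <= j)%N then i else j.
pose q := if (i <= j)%N then j else i.
have pq : (p + m./2 <= q)%N by rewrite /p /q; move: hgap; case: ifP => ?; lia.
have kpq : key (sf p) = key (sf q) by rewrite /p /q; case: ifP.
exists (key (sf p)).
have lt_m (k : 'I_(m./2).+1) : (p + k < m)%N.
  by have := ltn_ord k; have := ltn_ord q; lia.
pose g (k : 'I_(m./2).+1) := sf (Ordinal (lt_m k)).
have g_inj : injective g.
  by move=> k k' /sf_inj[] /addnI/val_inj.
have : (#|[set g k | k in [set: 'I_(m./2).+1]]| <= #|[set i | key i == key (sf p)]|)%N.
  apply/subset_leq_card/fintype.subsetP => _ /imsetP[k _ ->]; rewrite inE eqn_leq; apply/andP; split.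
    by rewrite kpq; apply: mono => /=; have := ltn_ord k; lia.
  by apply: mono => /=; lia.
by rewrite card_imset// cardsT card_ord; lia.
Qed.

End Shift.

Section Proportional.
Variable F : fieldType.
Implicit Types u v w : F * F.

Lemma bracket_trans w u v : w != (0, 0) -> bracket w u = 0 -> bracket w v = 0 -> bracket u v = 0.
Proof.
case: w u v => [w1 w2] [u1 u2] [v1 v2]; rewrite /bracket/= xpair_eqE negb_and.
move=> w0 /subr0_eq e1 /subr0_eq e2; case/orP: w0 => w0; apply: (mulfI w0).
  have -> : w1 * (u1 * v2 - u2 * v1) = u1 * (w1 * v2) - w1 * u2 * v1 by ring.
  by rewrite e1 e2; ring.
have -> : w2 * (u1 * v2 - u2 * v1) = w2 * u1 * v2 - u2 * (w2 * v1) by ring.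
by rewrite -e1 -e2; ring.
Qed.

Lemma bracketC u v : bracket u v = - bracket v u.
Proof. by rewrite /bracket; ring. Qed.

Lemma majority_class m (hm : (2 <= m)%N) (l : 'I_m -> F * F) :
  (forall i, l i != (0, 0)) ->
  (forall s : 'S_m, \prod_i bracket (l (s i)) (l (s (half_shift hm i))) = 0) ->
  exists i0, (m < 2 * #|[set j | bracket (l i0) (l j) == 0%R]|)%N.
Proof.
move=> l0 h.
(* The position of the first factor proportional to [l i] labels its class by a natural number, as
   [majority_key] requires. *)
pose key i := find (fun j => bracket (l j) (l i) == 0) (enum 'I_m).
have keyP i j : (key i == key j) = (bracket (l i) (l j) == 0).
  apply/eqP/idP => [kij|/eqP bij].
    have self i' : has (fun j => bracket (l j) (l i') == 0) (enum 'I_m).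
      by apply/hasP; exists i'; rewrite ?mem_enum// /bracket; apply/eqP; ring.
    have /eqP b1 := nth_find i (self i).
    have /eqP b2 := nth_find i (self j).
    rewrite -/(key i) in b1; rewrite -/(key j) -kij in b2.
    by apply/eqP; exact: bracket_trans (l0 _) b1 b2.
  apply: eq_find => k; apply/eqP/eqP => bk.
    by apply: bracket_trans (l0 i) _ bij; rewrite bracketC bk oppr0.
  by apply: bracket_trans (l0 j) _ _; rewrite bracketC ?bk ?bij oppr0.
have [s|v] := majority_key (hm := hm) (key := key).
  have /eqP/prodf_eq0[i _] := h s; rewrite -keyP => /eqP ki.
  by exists i.
set V := [set i | key i == v] => mV.
have /card_gt0P[i0] : (0 < #|V|)%N by move: mV; case: #|V|.
rewrite inE => /eqP ki0; exists i0; apply: leq_trans mV _.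
rewrite leq_mul2l/=; apply/subset_leq_card/fintype.subsetP => j; rewrite !inE -ki0 -keyP.
by rewrite eq_sym.
Qed.

End Proportional.

Lemma map_coef_subst (A B : comNzRingType) (g : {rmorphism A -> B}) m (e f : A * A) c :
  map_poly g (coef_subst m e f c) =
  coef_subst m (g e.1, g e.2) (g f.1, g f.2) (fun i => g (c i)).
Proof.
rewrite /coef_subst /form_eval rmorph_sum; apply: eq_bigr => i _.
by rewrite !rmorphM !rmorphXn/= !map_linpoly map_polyC.
Qed.

Lemma bracket_lineval (A : comNzRingType) (e f l l' : A * A) :
  bracket (lineval l e.1 e.2, lineval l f.1 f.2) (lineval l' e.1 e.2, lineval l' f.1 f.2) =
  bracket e f * bracket l l'.
Proof. by rewrite /bracket /lineval/=; ring. Qed.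

Lemma dvdp_exp_prod (F : fieldType) m (q : {poly F}) (p : 'I_m -> {poly F})
    (J : {set 'I_m}) :
  (forall j, j \in J -> q %| p j) -> q ^+ #|J| %| \prod_j p j.
Proof.
move=> h; rewrite (bigID (mem J))/= dvdp_mulr//.
rewrite -prodr_const; elim/big_rec2: _ => [|j p1 p2 jJ pp]; first exact: dvdpp.
by rewrite dvdp_mul// h.
Qed.

Section NullForms.
Variables (R : rcfType) (m : nat).
Local Notation C := R[i].
Local Notation rc := (real_complex R).
Implicit Types (a : 'rV[R]_m.+1) (l : 'I_m -> C * C) (e f : R * R).

Definition form_subst e f a : 'rV[R]_m.+1 :=
  poly_rV (coef_subst m e f (fun i => (rVpoly a)`_i)).

Lemma rVpoly_form_subst e f a :
  rVpoly (form_subst e f a) = coef_subst m e f (fun i => (rVpoly a)`_i).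
Proof. by rewrite poly_rV_K// size_coef_subst. Qed.

Lemma form_subst_form_subst e f e' f' a :
  form_subst e' f' (form_subst e f a) =
  form_subst (e.1 * e'.1 + f.1 * e'.2, e.2 * e'.1 + f.2 * e'.2)
        (e.1 * f'.1 + f.1 * f'.2, e.2 * f'.1 + f.2 * f'.2) a.
Proof. by rewrite {1}/form_subst rVpoly_form_subst coef_subst_coef_subst. Qed.

Definition factor_subst e f (l : 'I_m -> C * C) (j : 'I_m) : C * C :=
  (lineval (l j) (rc e.1) (rc e.2), lineval (l j) (rc f.1) (rc f.2)).

Lemma factored_form_subst e f a l : factored a l -> factored (form_subst e f a) (factor_subst e f l).
Proof.
rewrite /factored rVpoly_form_subst map_coef_subst => al.
rewrite -[RHS]/(\prod_i linpoly (lineval (l i) (rc e.1, rc e.2).1 (rc e.1, rc e.2).2,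
                       lineval (l i) (rc f.1, rc f.2).1 (rc f.1, rc f.2).2)).
rewrite -coef_subst_prod -al; apply: form_eval_ext => i _.
by rewrite coef_map.
Qed.

Lemma factored_exists a : (0 < m)%N -> exists l, factored a l.
Proof.
case: m a => // n a _; rewrite /factored.
have : (size (map_poly rc (rVpoly a)) <= n.+2)%N.
  by rewrite size_map_poly size_poly.
by move/linpoly_factor => [l ->]; exists l.
Qed.

Lemma factored_nonzero a l : a != 0 -> factored a l -> forall i, l i != (0, 0).
Proof.
move=> a0 al i; apply: contraNneq a0 => li.
have : map_poly rc (rVpoly a) = 0.
  rewrite al (bigD1 i)//= li /linpoly/= scale0r add0r.
  by rewrite mul0r.
move/eqP; rewrite map_poly_eq0 => /eqP p0.
by rewrite -[a]rVpolyK p0 linear0.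
Qed.

Lemma power_sum_coef_subst tau k e f l :
  power_sum tau k (factor_subst e f l) = rc (bracket e f ^+ (m * k)) * power_sum tau k l.
Proof.
rewrite /power_sum mulr_sumr; apply: eq_bigr => s _.
under eq_bigr do rewrite /factor_subst (bracket_lineval (rc e.1, rc e.2) (rc f.1, rc f.2)).
rewrite big_split/= prodr_const card_ord exprMn -exprM; congr (_ * _).
by rewrite rmorphXn/= /bracket rmorphB !rmorphM.
Qed.

(* A complex linear factor of multiplicity more than [m / 2] of a real form is
   real: otherwise its conjugate would also have that multiplicity. *)
Lemma real_majority a l (J : {set 'I_m}) (w : C * C) :
  a != 0 -> factored a l -> w != (0, 0) -> (m < 2 * #|J|)%N ->
  (forall j, j \in J -> bracket w (l j) = 0) ->
  exists2 f : R * R, f != (0, 0) & lineval w (rc f.1) (rc f.2) = 0.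
Proof.
move=> a0 al w0 mJ wJ; case: w w0 wJ => u v /= w0 wJ.
have [u0|u0] := eqVneq u 0.
  exists (1, 0); first by rewrite xpair_eqE oner_eq0.
  by rewrite /lineval/= u0 rmorph0 mul0r mulr0 addr0.
pose z := - v / u.
have zdv j : j \in J -> 'X - z%:P %| linpoly (l j).
  move=> /wJ; rewrite /bracket/= => /subr0_eq E.
  rewrite dvdp_XsubCl /root /linpoly hornerD hornerZ hornerX hornerC.
  apply/eqP/(mulfI u0); rewrite mulr0 mulrDr E /z.
  by field.
set p := map_poly rc (rVpoly a).
have p0 : p != 0.
  rewrite map_poly_eq0; apply: contra_neq a0 => q0.
  by rewrite -[a]rVpolyK q0 linear0.
have dz : ('X - z%:P) ^+ #|J| %| p by rewrite /p al dvdp_exp_prod.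
have dzc : ('X - (z^*)%:P) ^+ #|J| %| p.
  have -> : p = map_poly Num.conj p.
    by rewrite /p -map_poly_comp; apply: eq_map_poly => x; apply/esym/(conjc_real x).
  have -> : ('X - (z^*)%:P) ^+ #|J| = map_poly Num.conj (('X - z%:P) ^+ #|J|).
    by rewrite rmorphXn/= rmorphB/= map_polyX map_polyC.
  by rewrite dvdp_map.
have zr : z^* = z.
  apply/eqP/negPn/negP => zz.
  have cop : coprimep (('X - z%:P) ^+ #|J|) (('X - (z^*)%:P) ^+ #|J|).
    apply: coprimep_expl; apply: coprimep_expr.
    by rewrite coprimep_XsubC root_XsubC.
  have : ('X - z%:P) ^+ #|J| * ('X - (z^*)%:P) ^+ #|J| %| p by rewrite Gauss_dvdp// dz.
  move/dvdp_leq => /(_ p0); rewrite size_mul ?expf_neq0 ?polyXsubC_eq0//.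
  rewrite !size_exp_XsubC /p size_map_poly.
  have sa : (size (rVpoly a) <= m.+1)%N by rewrite size_poly.
  by move/leq_trans => /(_ _ sa); move: mJ; lia.
exists (complex.Re z, 1); first by rewrite xpair_eqE oner_eq0 andbF.
have -> : rc (complex.Re z, 1).1 = z.
  by move: zr; case: (z) => x y [] /eqP; rewrite eqNr => /eqP ->.
by rewrite /lineval/= rmorph1 /z; field.
Qed.

(** In a basis whose second vector [f] is the real zero of the majority factor, the coefficients of
    index below [#|J|] vanish. The diagonal substitution with entries [t] and [t^-1] multiplies the
    coefficient [i] by [t] to the power [2 * i - m], which is positive for [i >= #|J|]. *)
Lemma nullform_degenerates (hm : (2 <= m)%N) a l : a != 0 -> factored a l ->
  (forall s : 'S_m, \prod_i bracket (l (s i)) (l (s (half_shift hm i))) = 0) ->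
  forall eps : R, 0 < eps -> exists e f, bracket e f = 1 /\
    forall i, `|form_subst e f a 0 i| <= eps.
Proof.
move=> a0 al h eps eps0.
have l0 := factored_nonzero a0 al.
have [i0 mJ] := majority_class l0 h.
set J := [set j | _] in mJ.
have JP j : j \in J -> bracket (l i0) (l j) = 0 by rewrite inE => /eqP.
have [f f0 fl0] := real_majority a0 al (l0 i0) mJ JP.
have [e ef] : exists e, bracket e f = 1.
  case: f f0 {fl0} => f1 f2; rewrite xpair_eqE negb_and.
  have [->|f10] := eqVneq f1 0 => /= [f20|_].
    by exists (f2^-1, 0); rewrite /bracket/= mulVf// mul0r subr0.
  by exists (0, - f1^-1); rewrite /bracket/= mul0r mulNr mulVf// opprK add0r.
pose b := form_subst e f a.
have fb := factored_form_subst e f al.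
(* Every factor of the majority class vanishes at [f], so that its image is a multiple of ['X]. *)
have Xb : 'X^#|J| %| map_poly rc (rVpoly b).
  rewrite fb; apply: dvdp_exp_prod => j jJ.
  rewrite /factor_subst /linpoly/= (_ : lineval (l j) (rc f.1) (rc f.2) = 0).
    by rewrite addr0 -mul_polyC dvdp_mulIr.
  have b1 : bracket (l i0) (rc f.2, - rc f.1) = 0.
    rewrite /bracket/= -oppr0 -fl0 /lineval; ring.
  have := bracket_trans (l0 i0) (JP _ jJ) b1.
  by rewrite /bracket/lineval/= => /eqP; rewrite -oppr_eq0 => /eqP <-; ring.
have b0 (i : 'I_m.+1) : (i < #|J|)%N -> b 0 i = 0.
  move=> iJ; have /dvdpP[q qb] := Xb.
  have E : (map_poly rc (rVpoly b))`_i = rc (b 0 i).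
    by rewrite coef_map/= coef_rVpoly_ord.
  have : rc (b 0 i) = 0 by apply: etrans (esym E) _; rewrite qb coefMXn iJ.
  by move/eqP; rewrite fmorph_eq0 => /eqP.
pose M := \sum_i `|b 0 i|.
have M0 : 0 <= M by apply: sumr_ge0.
have bM i : `|b 0 i| <= M by rewrite /M (bigD1 i)//= lerDl sumr_ge0.
(* [t <= 1] bounds all positive powers of [t] by [t], and the quotient makes [t * M] at most [eps];
   the [+ 1] keeps the denominator positive when [M = 0]. *)
pose t := Num.min 1 (eps / (M + 1)).
have t0 : 0 < t by rewrite lt_min ltr01 divr_gt0// ltr_wpDl.
have t1 : t <= 1 by rewrite ge_min lexx.
have tM : t * M <= eps.
  apply: (@le_trans _ _ (eps / (M + 1) * M)).
    by rewrite ler_wpM2r// ge_min lexx orbT.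
  by rewrite mulrAC ler_pdivrMr ?ltr_wpDl// ler_pM2l// lerDl.
have bE i : form_subst (t, 0) (0, t^-1) b 0 i = t ^+ i * t^-1 ^+ (m - i) * b 0 i.
  have T (k : nat) : (((rVpoly b)`_k)%:P * linpoly (t, 0) ^+ k * linpoly (0, t^-1) ^+ (m - k))`_i =
      (rVpoly b)`_k * t ^+ k * t^-1 ^+ (m - k) * (i == k :> nat)%:R.
    have -> : ((rVpoly b)`_k)%:P * linpoly (t, 0) ^+ k * linpoly (0, t^-1) ^+ (m - k) =
        ((rVpoly b)`_k * t ^+ k * t^-1 ^+ (m - k))%:P * 'X^k.
      rewrite /linpoly/= scale0r addr0 add0r exprZn -mul_polyC -!polyC_exp !polyCM.
      by ring.
    by rewrite coefCM coefXn.
  rewrite /form_subst mxE /coef_subst /form_eval coef_sum (bigD1 i)//= big1 ?addr0 => [|k ki].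
    by rewrite T eqxx mulr1 coef_rVpoly_ord -mulrA mulrC.
  rewrite T (_ : (i == k :> nat) = false) ?mulr0//.
  by apply: negbTE; move: ki; rewrite eq_sym.
exists (e.1 * t + f.1 * 0, e.2 * t + f.2 * 0),
  (e.1 * 0 + f.1 * t^-1, e.2 * 0 + f.2 * t^-1); split; last first.
  move=> i; rewrite -(form_subst_form_subst e f (t, 0) (0, t^-1)) -/b bE.
  have [iJ|iJ] := ltnP i #|J|; first by rewrite b0// mulr0 normr0 ltW.
  rewrite normrM; apply: le_trans tM; apply: ler_pM => //.
  have im : (m - i < i)%N.
    have := ltn_ord i; have : (m < 2 * i)%N by rewrite (leq_trans mJ)// leq_mul2l.
    by lia.
  have -> : t ^+ i * t^-1 ^+ (m - i) = t ^+ (i - (m - i)).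
    by rewrite exprVn (expfB t im).
  rewrite ger0_norm ?exprn_ge0 ?(ltW t0)//. 
  rewrite (_ : (i - (m - i) = (i - (m - i)).-1.+1)%N); last by lia.
  by rewrite exprS ger_pMr// exprn_ile1// ltW.
rewrite -ef /bracket/=; field; exact: lt0r_neq0.
Qed.

End NullForms.

Lemma form_invariant (R : rcfType) (m : nat) (hm : (2 <= m)%N) :
  exists (P : mpoly m.+1 R) (r D : nat),
  [/\ (0 < r)%N /\ homog r P, P != 0,
      forall a : 'rV[R]_m.+1, 0 <= meval (a 0) P,
      forall e f (a : 'rV[R]_m.+1),
        meval (form_subst e f a 0) P = bracket e f ^+ D * meval (a 0) P &
      forall a : 'rV[R]_m.+1, a != 0 -> meval (a 0) P = 0 ->
        forall eps : R, 0 < eps -> exists e f, bracket e f = 1 /\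
          forall i, `|form_subst e f a 0 i| <= eps].
Proof.
have m0 : (0 < m)%N by exact: ltn_trans hm.
pose tau := half_shift hm.
(* There are as many power sums as [power_sums_eq0] asks for. [L] is a common multiple of 1, ...,
   [N.+1]: the squared modulus of the power sum of exponent [k.+1] has degree [4 * k.+1] and weight
   [2 * m * k.+1], so its power [L %/ k.+1] has degree [4 * L] and weight [2 * m * L] for every
   [k]. *)
pose N := #|{perm 'I_m}|; pose L := N.+1`!.
have H (k : 'I_N.+1) := invariant_power_sum R tau k.
have [P1 {}H] := fin_all_exists H; have {H}[P2 H] := fin_all_exists H.
pose nrm k := P1 k ^+ 2 + P2 k ^+ 2.
pose P : mpoly m.+1 R := \sum_(k < N.+1) nrm k ^+ (L %/ k.+1).
have Ldvd (k : 'I_N.+1) : (L %/ k.+1 * k.+1 = L)%N.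
  by rewrite divnK// dvdn_fact//=.
have nrmE k a : meval (a 0) (nrm k) = meval (a 0) (P1 k) ^+ 2 + meval (a 0) (P2 k) ^+ 2.
  by rewrite mevalD !rmorphXn.
have nrm_ge0 k (a : 'rV[R]_m.+1) : 0 <= meval (a 0) (nrm k).
  by rewrite nrmE addr_ge0// sqr_ge0.
have PE (a : 'rV[R]_m.+1) : meval (a 0) P = \sum_(k < N.+1) meval (a 0) (nrm k) ^+ (L %/ k.+1).
  by rewrite raddf_sum/=; apply: eq_bigr => k _; rewrite rmorphXn.
have P_eq0 a l : factored a l -> meval (a 0) P = 0 ->
    forall s : 'S_m, \prod_i bracket (l (s i)) (l (s (tau i))) = 0.
  move=> al; rewrite PE => /eqP; rewrite psumr_eq0; last by move=> k _; rewrite exprn_ge0.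
  move=> /allP h; apply: power_sums_eq0 => k kN.
  have kN' : (k < N.+1)%N by rewrite ltnS.
  have := h (Ordinal kN'); rewrite mem_index_enum => /(_ isT)/=.
  rewrite expf_eq0 => /andP[_]; rewrite nrmE paddr_eq0 ?sqr_ge0// !sqrf_eq0.
  move=> /andP[/eqP z1 /eqP z2].
  by have [_ _ /(_ _ _ al)] := H (Ordinal kN'); rewrite z1 z2.
exists P, (4 * L)%N, (2 * m * L)%N; split.
- split; first by rewrite muln_gt0 fact_gt0.
  apply: rpred_sum => k _.
  have -> : (4 * L = 4 * k.+1 * (L %/ k.+1))%N by rewrite -mulnA [(k.+1 * _)%N]mulnC Ldvd.
  apply: dhomogMn; have [h1 h2 _] := H k.
  have -> : (4 * k.+1 = (k.+1 + k.+1) * 2)%N by lia.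
  by apply: rpredD; apply: dhomogMn.
(* The form with the distinct roots 0, ..., [m - 1] witnesses [P != 0]: the product of the identity
   permutation is nonzero, as [half_shift] has no fixed point. *)
- pose l (i : 'I_m) : R[i] * R[i] := (1, - i%:R).
  pose lr (i : 'I_m) : R * R := (1, - i%:R).
  pose a : 'rV[R]_m.+1 := poly_rV (\prod_i linpoly (lr i)).
  have al : factored a l.
    rewrite /factored poly_rV_K ?size_prod_linpoly// rmorph_prod/=; apply: eq_bigr => i _.
    by rewrite map_linpoly/= rmorph1 rmorphN rmorph_nat.
  apply/eqP => P0; have := P_eq0 _ _ al; rewrite P0 meval0 => /(_ erefl 1%g)/eqP.
  move/prodf_eq0 => [i _]; rewrite !perm1 /bracket/= mul1r mulr1 opprK addrC subr_eq0.
  by rewrite eqr_nat val_eqE eq_sym (negPf (half_shift_neq _ _)).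
- by move=> a; rewrite PE sumr_ge0// => k _; rewrite exprn_ge0.
- move=> e f a; rewrite !PE mulr_sumr; apply: eq_bigr => k _.
  have [l al] := factored_exists a m0.
  have [_ _ E] := H k.
  have := E _ _ (factored_form_subst e f al); rewrite power_sum_coef_subst (E _ _ al) => /eqP.
  rewrite eq_complex/= !mul0r subr0 addr0 => /andP[/eqP z1 /eqP z2].
  rewrite !nrmE -z1 -z2 !exprMn -mulrDr exprMn; congr (_ * _).
  rewrite -!exprM; congr (_ ^+ _).
  by rewrite -[in RHS](Ldvd k); ring.
move=> a a0 Pa0; have [l al] := factored_exists a m0.
exact: (nullform_degenerates a0 al (P_eq0 _ _ al Pa0)).
Qed.

(** * Plane measure and triangles *)

Section PlaneMeasure.
Local Open Scope classical_set_scope.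
Local Open Scope ring_scope.
Variable R : realType.
Local Notation RR := (measurableTypeR R).
Local Notation lambda := (@lebesgue_measure R).
Local Notation mu := (lambda \x lambda)%E.
Local Notation plane := (RR * RR)%type.

Lemma measurable_affine (s t : R) : measurable_fun [set: RR] (fun x : RR => s * x + t : RR).
Proof. by apply: measurable_funD => //; apply: measurable_funM. Qed.

(** By uniqueness of the Lebesgue measure it suffices to compare with [|s|] times the pushforward on
    half-open intervals; a negative slope exchanges the open and the closed end. *)
Lemma lebesgue_affine (s t : R) (B : set RR) : s != 0 -> measurable B ->
  lambda ((fun x : RR => s * x + t : RR) @^-1` B) = (`|s|^-1%:E * lambda B)%E.
Proof.
move=> s0 mB.
have ns0 : 0 <= `|s| by [].
pose k := NngNum ns0.
pose f := (fun x : RR => s * x + t : RR).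
have mf : measurable_fun [set: RR] f by exact: measurable_affine.
rewrite -/f; have fE x : f x = s * x + t by []; clearbody f.
suff H : lambda B = (`|s|%:E * lambda (f @^-1` B))%E.
  by rewrite H muleA -EFinM mulVf ?normr_eq0// mul1e.
apply: (lebesgue_measure_unique (mu := mscale k (pushforward lambda f))) => // _ [[a b]] _ <-.
rewrite -[RHS]/(`|s|%:E * lambda (f @^-1` `]a, b]))%E lebesgue_measure_itv/= lte_fin.
have [ab|ba] := ltP a b; last first.
  rewrite (_ : f @^-1` _ = set0) ?measure0 ?mule0//.
  rewrite -subset0 => x /=; rewrite in_itv/= => /andP[ax xb].
  by have := lt_le_trans ax xb; rewrite ltNge ba.
have [sn|sp] := ltrP s 0.
  rewrite (_ : f @^-1` _ = [set` `[((b - t) / s), ((a - t) / s)[ ]); last first.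
    apply/seteqP; split => x /=; rewrite !in_itv/= fE.
      by move=> /andP[ax xb]; rewrite ler_ndivrMr// ltr_ndivlMr//; apply/andP; split; lra.
    by rewrite ler_ndivrMr// ltr_ndivlMr// => /andP[ax xb]; apply/andP; split; lra.
  rewrite lebesgue_measure_itv/= lte_fin ltr_ndivrMr// divfK// ltrD2r ab.
  by rewrite -!EFinB -EFinM ltr0_norm//; congr _%:E; field.
have {}sp : 0 < s by rewrite lt_def s0.
rewrite (_ : f @^-1` _ = [set` `]((a - t) / s), ((b - t) / s)] ]); last first.
  apply/seteqP; split => x /=; rewrite !in_itv/= fE.
    by move=> /andP[ax xb]; rewrite ler_pdivlMr// ltr_pdivrMr//; apply/andP; split; lra.
  by rewrite ler_pdivlMr// ltr_pdivrMr// => /andP[ax xb]; apply/andP; split; lra.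
rewrite lebesgue_measure_itv/= lte_fin ltr_pdivlMr// divfK// ltrD2r ab.
by rewrite -!EFinB -EFinM gtr0_norm//; congr _%:E; field.
Qed.

Lemma mule_cancel (u u' v v' : R) (x y : \bar R) : u * u' = 1 -> v * v' = 1 ->
  ((u * v)%:E * ((u'%:E * x) * (v'%:E * y)) = x * y)%E.
Proof.
by move=> uu vv; rewrite -muleA (muleCA x) !muleA -!EFinM -mulrA mulrACA uu vv mulr1 mul1e.
Qed.

(** Stated for preimages, hence for the pushforward, to which uniqueness of product measures
    applies. For an invertible linear map [c] is the inverse of the absolute value of the
    determinant. *)
Definition rescales (f : plane -> plane) (c : R) :=
  measurable_fun [set: plane] f /\
  forall B, measurable B -> mu (f @^-1` B) = (c%:E * mu B)%E.

Lemma rescales_comp f g c d : rescales f c -> rescales g d ->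
  rescales (f \o g) (c * d).
Proof.
move=> [mf hf] [mg hg]; split; first exact: measurableT_comp.
move=> B mB; rewrite comp_preimage hg; last first.
  by rewrite -[X in measurable X]setTI; exact: mf.
by rewrite hf// muleA -EFinM mulrC.
Qed.

Lemma rescales_diag (s t a b : R) : s != 0 -> t != 0 ->
  rescales (fun z => (s * z.1 + a, t * z.2 + b)) (`|s|^-1 * `|t|^-1).
Proof.
move=> s0 t0; pose f z : plane := (s * z.1 + a, t * z.2 + b).
have mf : measurable_fun [set: plane] f.
  apply: measurable_fun_pair.
    by apply: (measurableT_comp (measurable_affine s a)); exact: measurable_fst.
  by apply: (measurableT_comp (measurable_affine t b)); exact: measurable_snd.
split => // B mB.
have c0 : 0 <= `|s| * `|t| by rewrite mulr_ge0.
suff H : mu B = ((`|s| * `|t|)%:E * mu (f @^-1` B))%E.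
  rewrite H muleA -EFinM (_ : _ * _ = 1) ?mul1e//.
  by field; rewrite !normr_eq0 s0 t0.
apply: (product_measure_unique (m' := mscale (NngNum c0) (pushforward mu f))) => //.
move=> A1 A2 mA1 mA2; rewrite -[LHS]/((`|s| * `|t|)%:E * mu (f @^-1` (A1 `*` A2)))%E.
rewrite (_ : f @^-1` (A1 `*` A2) =
  ((fun x : RR => s * x + a : RR) @^-1` A1) `*` ((fun x : RR => t * x + b : RR) @^-1` A2))//.
rewrite product_measure1E; last 2 first.
- by rewrite -[X in measurable X]setTI; apply: measurable_affine.
- by rewrite -[X in measurable X]setTI; apply: measurable_affine.
transitivity ((`|s| * `|t|)%:E * ((`|s|^-1%:E * lambda A1) * (`|t|^-1%:E * lambda A2)))%E.
  by congr (_ * (_ * _))%E; exact: lebesgue_affine.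
by apply: mule_cancel; rewrite mulfV ?normr_eq0.
Qed.

Lemma rescales_swap : rescales (fun z => (z.2, z.1)) 1.
Proof.
pose f z : plane := (z.2, z.1).
have mf : measurable_fun [set: plane] f.
  by apply: measurable_fun_pair; [exact: measurable_snd|exact: measurable_fst].
split => // B mB; rewrite mul1e; symmetry.
apply: (product_measure_unique (m' := pushforward mu f)) => //.
move=> A1 A2 mA1 mA2; rewrite -[LHS]/(mu (f @^-1` (A1 `*` A2))).
rewrite (_ : f @^-1` (A1 `*` A2) = A2 `*` A1); last first.
  by apply/seteqP; split => -[x y] /= [].
by rewrite [LHS]product_measure1E// muleC.
Qed.

(** The section of the preimage at [x] is the section of [B] translated by [t * x], so that both
    have the same length. *)
Lemma rescales_shear (t : R) : rescales (fun z => (z.1, z.2 + t * z.1)) 1.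
Proof.
split.
  apply: measurable_fun_pair; first exact: measurable_fst.
  apply: measurable_funD; first exact: measurable_snd.
  by apply: measurable_funM => //; exact: measurable_fst.
move=> B mB; rewrite mul1e; apply: eq_integral => x _ /=.
rewrite (_ : xsection _ x = (fun y : RR => 1 * y + t * x : RR) @^-1` xsection B x).
  rewrite lebesgue_affine ?oner_eq0//; last exact: measurable_xsection.
  by rewrite normr1 invr1 mul1e.
by apply/seteqP; split => y; rewrite /xsection/= !inE/= mul1r.
Qed.

Lemma rescales_ext f g c : f =1 g -> rescales f c -> rescales g c.
Proof. by move=> /funext ->. Qed.

Lemma rescales_linear (a b c d : R) : a * d - b * c != 0 ->
  rescales (fun z => (a * z.1 + b * z.2, c * z.1 + d * z.2)) `|a * d - b * c|^-1.
Proof.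
(* If [a = 0] then [c] is nonzero, and exchanging the rows changes only the sign of the
   determinant. *)
wlog a0 : a b c d / a != 0 => [wlg|].
  move=> det0; have [a0|a0] := eqVneq a 0; last exact: wlg.
  have c0 : c != 0 by move: det0; rewrite a0 mul0r sub0r oppr_eq0 mulf_eq0 negb_or => /andP[].
  have H : rescales (fun z => (c * z.1 + d * z.2, a * z.1 + b * z.2)) `|c * b - d * a|^-1.
    by apply: wlg => //; rewrite -oppr_eq0 opprB mulrC [c * b]mulrC.
  have := rescales_comp rescales_swap H; rewrite mul1r -normrN.
  by rewrite opprB mulrC [c * b]mulrC.
move=> det0.
have D0 : (a * d - b * c) / a != 0 by rewrite mulf_neq0 ?invr_eq0.
(* [a b; c d] = [1 0; c/a 1] [a 0; 0 det/a] [1 b/a; 0 1] *)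
have H := rescales_comp (rescales_shear (c / a)) (rescales_comp (rescales_diag 0 0 a0 D0)
  (rescales_comp rescales_swap (rescales_comp (rescales_shear (b / a)) rescales_swap))).
rewrite (_ : `|_|^-1 = 1 * (`|a|^-1 * `|(a * d - b * c) / a|^-1 * (1 * (1 * 1)))); last first.
  by rewrite normrM normfV; field; rewrite !normr_eq0 a0.
apply: rescales_ext H => -[x y] /=; rewrite !addr0.
by congr (_, _); field.
Qed.


End PlaneMeasure.

(** * Affine maps and the area of triangles *)

Section AffineMaps.
Local Open Scope classical_set_scope.
Local Open Scope ring_scope.
Variable R : realType.
Local Notation RR := (measurableTypeR R).
Local Notation lambda := (@lebesgue_measure R).
Local Notation mu := (lambda \x lambda)%E.
Local Notation plane := (RR * RR)%type.
Implicit Types (p e f z w : R * R).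

Definition aff p e f z : R * R :=
  (p.1 + e.1 * z.1 + f.1 * z.2, p.2 + e.2 * z.1 + f.2 * z.2).

Definition aff_inv p e f w : R * R :=
  ((f.2 * (w.1 - p.1) - f.1 * (w.2 - p.2)) / bracket e f,
   (e.1 * (w.2 - p.2) - e.2 * (w.1 - p.1)) / bracket e f).

Lemma affK p e f : bracket e f != 0 -> cancel (aff p e f) (aff_inv p e f).
Proof.
move: p e f => [p1 p2] [e1 e2] [f1 f2] D0 [x y]; rewrite /aff /aff_inv /bracket/= in D0 *.
by congr (_, _); field.
Qed.

Lemma aff_invK p e f : bracket e f != 0 -> cancel (aff_inv p e f) (aff p e f).
Proof.
move: p e f => [p1 p2] [e1 e2] [f1 f2] D0 [x y]; rewrite /aff /aff_inv /bracket/= in D0 *.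
by congr (_, _); field.
Qed.

(** Exhibits the inverse as an affine map in the same format, so that measurability and
    polynomiality known for [aff] carry over to it. *)
Definition aff_inv_param p e f :=
  (aff_inv p e f (0, 0), (f.2 / bracket e f, - e.2 / bracket e f), (- f.1 / bracket e f, e.1 / bracket e f)).

Lemma aff_invE p e f w :
  aff_inv p e f w = aff (aff_inv_param p e f).1.1 (aff_inv_param p e f).1.2
                        (aff_inv_param p e f).2 w.
Proof.
by move: p e f w => [p1 p2] [e1 e2] [f1 f2] [x y]; rewrite /aff /aff_inv /=; congr (_, _); ring.
Qed.

Lemma measurable_aff p e f : measurable_fun [set: plane] (aff p e f : plane -> plane).
Proof.
have mlin (a b c : R) : measurable_fun [set: plane] (fun z : plane => a + b * z.1 + c * z.2 : RR).
  apply: measurable_funD; last by apply: measurable_funM => //; exact: measurable_snd.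
  by apply: measurable_funD => //; apply: measurable_funM => //; exact: measurable_fst.
exact: (measurable_fun_pair (mlin p.1 e.1 f.1) (mlin p.2 e.2 f.2)).
Qed.

Lemma measurable_aff_inv p e f : measurable_fun [set: plane] (aff_inv p e f : plane -> plane).
Proof.
have -> : aff_inv p e f = aff (aff_inv_param p e f).1.1 (aff_inv_param p e f).1.2
    (aff_inv_param p e f).2 by apply/funext; exact: aff_invE.
exact: measurable_aff.
Qed.

Lemma rescales_aff p e f : bracket e f != 0 -> rescales (aff p e f) `|bracket e f|^-1.
Proof.
move=> D0.
have D0' : e.1 * f.2 - f.1 * e.2 != 0 by rewrite [f.1 * _]mulrC.
have one0 : (1 : R) != 0 by exact: oner_neq0.
have H := rescales_comp (rescales_diag p.1 p.2 one0 one0) (rescales_linear D0').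
rewrite normr1 invr1 !mul1r [f.1 * _]mulrC in H.
apply: rescales_ext H => z; rewrite /aff/= !mul1r.
by congr (_, _); ring.
Qed.

Lemma aff_image p e f (B : set (R * R)) : bracket e f != 0 ->
  aff p e f @` B = aff_inv p e f @^-1` B.
Proof.
move=> D0; apply/seteqP; split => [_ [z Bz <-]|w Bw] /=; first by rewrite affK.
by exists (aff_inv p e f w) => //; rewrite aff_invK.
Qed.

Lemma measurable_aff_image p e f (B : set plane) : bracket e f != 0 -> measurable B ->
  measurable (aff p e f @` B : set plane).
Proof.
move=> D0 mB; rewrite aff_image// -[X in measurable X]setTI.
exact: measurable_aff_inv.
Qed.

Lemma mu_aff_image p e f (B : set plane) : bracket e f != 0 -> measurable B ->
  mu (aff p e f @` B) = (`|bracket e f|%:E * mu B)%E.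
Proof.
move=> D0 mB; have [_ H] := rescales_aff p D0.
have mI := measurable_aff_image p D0 mB.
have := H _ mI; rewrite (_ : aff p e f @^-1` _ = B); last first.
  apply/seteqP; split => [z [z' Bz' E]|z Bz]; last by exists z.
  by rewrite -(can_inj (affK p D0) E).
by move=> ->; rewrite muleA -EFinM mulfV ?mul1e// normr_eq0.
Qed.

Definition stdtri : set (R * R) := [set z | [/\ 0 <= z.1, 0 <= z.2 & z.1 + z.2 <= 1]].

Lemma measurable_halfplane (a b c : R) :
  measurable ([set z | 0 <= a + b * z.1 + c * z.2] : set plane).
Proof.
pose f (z : plane) : RR := a + b * z.1 + c * z.2.
have mf : measurable_fun [set: plane] f.
  apply: measurable_funD; last by apply: measurable_funM => //; exact: measurable_snd.
  by apply: measurable_funD => //; apply: measurable_funM => //; exact: measurable_fst.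
rewrite (_ : [set z | _] = [set: plane] `&` f @^-1` `[0, +oo[); first exact: mf.
by apply/seteqP; split => z /=; rewrite in_itv/= andbT; [|case].
Qed.

Lemma stdtriE : stdtri = [set z | 0 <= 0 + 1 * z.1 + 0 * z.2] `&`
  ([set z | 0 <= 0 + 0 * z.1 + 1 * z.2] `&` [set z | 0 <= 1 + (-1) * z.1 + (-1) * z.2]).
Proof.
apply/seteqP; split => -[x y] /= => [[/= x0 y0 xy]|[x0 [y0 xy]]]; last by split => /=; lra.
by split; [|split]; lra.
Qed.

Lemma measurable_stdtri : measurable (stdtri : set plane).
Proof.
rewrite stdtriE; apply: measurableI; first exact: measurable_halfplane.
by apply: measurableI; exact: measurable_halfplane.
Qed.

Lemma stdtri_sub : stdtri `<=` `[0, 1]%classic `*` `[0, 1]%classic.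
Proof.
by move=> [x y] []/= x0 y0 xy; split; rewrite /= in_itv/=; apply/andP; split; lra.
Qed.

Lemma sub_stdtri : `[0, 2^-1]%classic `*` `[0, 2^-1]%classic `<=` stdtri.
Proof.
by move=> [x y] []/=; rewrite !in_itv/= => /andP[? ?] /andP[? ?]; split => /=; lra.
Qed.

(** A square of side 1/2 inside and one of side 1 around the triangle make its area positive and
    finite; later constants are expressed through [alpha]. *)
Lemma mu_stdtri : exists2 alpha : R, 0 < alpha & mu stdtri = alpha%:E.
Proof.
have le1 : (mu stdtri <= 1)%E.
  apply: (@le_trans _ _ (mu (`[0, 1]%classic `*` `[0, 1]%classic))).
    apply: le_measure; rewrite ?inE//=.
    - exact: measurable_stdtri.
    - by apply: measurableX; exact: measurable_itv.
    - exact: stdtri_sub.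
  rewrite product_measure1E; [|exact: measurable_itv|exact: measurable_itv].
  rewrite [X in (X * _)%E](_ : _ = 1%E) ?[X in (_ * X)%E](_ : _ = 1%E) ?mule1//;
    by rewrite /= lebesgue_measure_itv/= lte_fin ltr01 oppr0 adde0.
have ge : ((2^-1 * 2^-1)%:E <= mu stdtri)%E.
  apply: (@le_trans _ _ (mu (`[0, 2^-1]%classic `*` `[0, 2^-1]%classic))).
    rewrite product_measure1E; [|exact: measurable_itv|exact: measurable_itv].
    rewrite [X in (_ <= X * _)%E](_ : _ = 2^-1%:E) ?[X in (_ <= _ * X)%E](_ : _ = 2^-1%:E) ?EFinM//;
      by rewrite /= lebesgue_measure_itv/= lte_fin invr_gt0 ltr0n oppr0 adde0.
  apply: le_measure; rewrite ?inE//=.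
  - by apply: measurableX; exact: measurable_itv.
  - exact: measurable_stdtri.
  - exact: sub_stdtri.
have fin : mu stdtri \is a fin_num.
  by rewrite ge0_fin_numE// (le_lt_trans le1)// ltry.
exists (fine (mu stdtri)); last by rewrite fineK.
by rewrite -lte_fin fineK// (lt_le_trans _ ge)// lte_fin mulr_gt0// invr_gt0.
Qed.

Section Triangle.
Local Open Scope classical_set_scope.
Local Open Scope ring_scope.
Variable T : 'I_3 -> R * R.

Definition side1 := T (lift ord0 ord0) - T ord0.
Definition side2 := T (lift ord0 (lift ord0 ord0)) - T ord0.

Lemma sum_ord3 (F : 'I_3 -> R) :
  \sum_i F i = F ord0 + F (lift ord0 ord0) + F (lift ord0 (lift ord0 ord0)).
Proof.
by rewrite !big_ord_recl big_ord0 addr0 addrA.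
Qed.

Definition bary3 (x y : R) (i : 'I_3) : R :=
  if i == ord0 then 1 - x - y else if i == lift ord0 ord0 then x else y.

Lemma bary_point_aff (l : 'I_3 -> R) : \sum_i l i = 1 ->
  bary_point T l = aff (T ord0) side1 side2 (l (lift ord0 ord0), l (lift ord0 (lift ord0 ord0))).
Proof.
rewrite /bary_point !sum_ord3 => l1.
have -> : l ord0 = 1 - l (lift ord0 ord0) - l (lift ord0 (lift ord0 ord0)).
  by rewrite -l1; ring.
by rewrite /aff /side1 /side2 /=; congr (_, _); ring.
Qed.

Lemma sum_bary3 x y : \sum_i bary3 x y i = 1.
Proof. by rewrite sum_ord3 /bary3 /=; ring. Qed.

Lemma tri_aff : tri T = aff (T ord0) side1 side2 @` stdtri.
Proof.
apply/seteqP; split => [_ [l [l0 l1 ->]]|_ [[x y] [/= x0 y0 xy] <-]].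
  rewrite bary_point_aff//; eexists; last reflexivity.
  split => //=; rewrite -l1 sum_ord3; have := l0 ord0; lra.
exists (bary3 x y); split; last by rewrite (bary_point_aff (sum_bary3 x y)).
  by move=> i; rewrite /bary3; case: ifP => _; [lra|case: ifP => _; lra].
exact: sum_bary3.
Qed.

Lemma nondegenerateP : Defs.nondegenerate T <-> bracket side1 side2 != 0.
Proof.
split=> [nT|D0 l l0 lT].
  have key a b : a * side1.1 + b * side2.1 = 0 -> a * side1.2 + b * side2.2 = 0 -> a = 0 /\ b = 0.
    move=> h1 h2; pose l (i : 'I_3) := if i == ord0 then - a - b else
       if i == lift ord0 ord0 then a else b.
    have H := nT l.
    have l0 : \sum_i l i = 0 by rewrite sum_ord3 /l/=; ring.
    have lT : bary_point T l = (0, 0).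
      rewrite /bary_point !sum_ord3 /l/=; congr (_, _).
        by rewrite -[RHS]h1 /side1 /side2/=; ring.
      by rewrite -[RHS]h2 /side1 /side2/=; ring.
    have {}H := H l0 lT.
    by split; [exact: (H (lift ord0 ord0))|exact: (H (lift ord0 (lift ord0 ord0)))].
  (* With determinant 0, [(side2.1, - side1.1)] and [(side2.2, - side1.2)] are linear relations
     between the sides. By [key] both sides are then 0, and [(1, 0)] is a relation that contradicts
     [key]. *)
  apply/eqP; rewrite /bracket => D0.
  have [f1 /eqP] : side2.1 = 0 /\ - side1.1 = 0.
    by apply: key; [ring|rewrite -[RHS]oppr0 -D0; ring].
  rewrite oppr_eq0 => /eqP e1.
  have [f2 /eqP] : side2.2 = 0 /\ - side1.2 = 0.
    by apply: key; [rewrite -[RHS]D0; ring|ring].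
  rewrite oppr_eq0 => /eqP e2.
  have [/eqP] : (1 : R) = 0 /\ (0 : R) = 0 by apply: key; rewrite ?e1 ?e2; ring.
  by rewrite oner_eq0.
have h1 := congr1 fst lT; have h2 := congr1 snd lT.
rewrite /bary_point/= !sum_ord3 in h1 h2; rewrite sum_ord3 in l0.
set a := l (lift ord0 ord0) in h1 h2 l0 *; set b := l (lift ord0 (lift ord0 ord0)) in h1 h2 l0 *.
have l0E : l ord0 = - a - b by rewrite -[LHS]subr0 -l0; ring.
have g1 : a * side1.1 + b * side2.1 = 0 by rewrite -h1 l0E /side1 /side2/=; ring.
have g2 : a * side1.2 + b * side2.2 = 0 by rewrite -h2 l0E /side1 /side2/=; ring.
have a0 : a = 0.
  apply: (mulIf D0); rewrite mul0r /bracket.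
  transitivity ((a * side1.1 + b * side2.1) * side2.2 - (a * side1.2 + b * side2.2) * side2.1); first by ring.
  by rewrite g1 g2; ring.
have b0 : b = 0.
  apply: (mulIf D0); rewrite mul0r /bracket.
  transitivity ((a * side1.2 + b * side2.2) * side1.1 - (a * side1.1 + b * side2.1) * side1.2); first by ring.
  by rewrite g1 g2; ring.
move=> i; have [->|] := eqVneq i ord0; first by rewrite l0E a0 b0 subr0 oppr0.
have [->//|] := eqVneq i (lift ord0 ord0).
have [->//|] := eqVneq i (lift ord0 (lift ord0 ord0)).
by case: i => -[|[|[|]]].
Qed.

Lemma areaE : bracket side1 side2 != 0 -> area T = (`|bracket side1 side2|%:E * mu stdtri)%E.
Proof.
by move=> D0; rewrite /area tri_aff mu_aff_image//; exact: measurable_stdtri.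
Qed.

End Triangle.
End AffineMaps.

(** * Polynomial functions and interpolation *)

Section PolynomialFunctions.
Local Open Scope classical_set_scope.
Local Open Scope ring_scope.
Variable R : realType.
Implicit Types (f g : R * R -> R) (z : R * R) (c : R).

Definition polyfun d f := exists2 q : mpoly 2 R, (msize q <= d)%N & f = eval2 q.

Lemma polyfun_le d d' f : (d <= d')%N -> polyfun d f -> polyfun d' f.
Proof. by move=> dd [q sq ->]; exists q => //; exact: leq_trans dd. Qed.

Lemma polyfunD d f g : polyfun d f -> polyfun d g -> polyfun d (fun z => f z + g z).
Proof.
move=> [q sq ->] [r sr ->]; exists (q + r).
  by rewrite (leq_trans (msizeD_le _ _))// geq_max sq.
by apply/funext => z; rewrite /eval2 mevalD.
Qed.

Lemma polyfunZ d c f : polyfun d f -> polyfun d (fun z => c * f z).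
Proof.
move=> [q sq ->]; exists (c *: q); first exact: leq_trans (msizeZ_le _ _) sq.
by apply/funext => z; rewrite /eval2 mevalZ.
Qed.

Lemma polyfunB d f g : polyfun d f -> polyfun d g -> polyfun d (fun z => f z - g z).
Proof.
move=> bf bg; have := polyfunD bf (polyfunZ (-1) bg).
by congr polyfun; apply/funext => z; rewrite mulN1r.
Qed.

Lemma polyfun0 d : polyfun d (fun=> 0).
Proof. by exists 0; rewrite ?msize0//; apply/funext => z; rewrite /eval2 meval0. Qed.

Lemma polyfun_sum d n (F : 'I_n -> R * R -> R) : (forall i, polyfun d (F i)) ->
  polyfun d (fun z => \sum_i F i z).
Proof.
elim: n F => [|n IH] F h.
  by have := polyfun0 d; congr polyfun; apply/funext => z; rewrite big_ord0.
have := polyfunD (IH (fun i => F (widen_ord (leqnSn n) i)) (fun i => h _)) (h ord_max).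
by congr polyfun; apply/funext => z; rewrite big_ord_recr.
Qed.

(** Degree at most [d] times degree less than [e]: the asymmetric bound is the one used to compare
    leading parts of products. *)
Lemma polyfunM d e f g : polyfun d.+1 f -> polyfun e g -> polyfun (d + e) (fun z => f z * g z).
Proof.
move=> [q sq ->] [r sr ->]; exists (q * r); last first.
  by apply/funext => z; rewrite /eval2 mevalM.
have [->|q0] := eqVneq q 0; first by rewrite mul0r msize0.
have [->|r0] := eqVneq r 0; first by rewrite mulr0 msize0.
by rewrite msizeM// -subn1 leq_subLR add1n -addSn leq_add.
Qed.

Lemma polyfun_cst c : polyfun 1 (fun=> c).
Proof.
exists (mpolyC 2 c); first by rewrite msizeC; case: (c != 0).
by apply/funext => z; rewrite /eval2 mevalC.
Qed.

Lemma polyfun_fst : polyfun 2 fst.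
Proof.
exists (mpolyX R (mnm1 ord0)); first by rewrite msizeX mdeg1.
by apply/funext => z; rewrite /eval2 mevalXU.
Qed.

Lemma polyfun_snd : polyfun 2 snd.
Proof.
exists (mpolyX R (mnm1 ord_max)); first by rewrite msizeX mdeg1.
by apply/funext => z; rewrite /eval2 mevalXU.
Qed.

Lemma polyfunX f k : polyfun 2 f -> polyfun k.+1 (fun z => f z ^+ k).
Proof.
move=> bf; elim: k => [|k IH].
  by have := polyfun_cst 1; congr polyfun; apply/funext => z; rewrite expr0.
have := polyfunM bf IH; rewrite add1n.
by congr polyfun; apply/funext => z; rewrite exprS.
Qed.

Lemma eval2E (q : mpoly 2 R) : eval2 q = fun z =>
  \sum_(k <- msupp q) mcoeff k q * (z.1 ^+ k ord0 * z.2 ^+ k ord_max).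
Proof.
apply/funext => z; rewrite /eval2 mevalE; apply: eq_bigr => k _.
rewrite !big_ord_recl big_ord0 mulr1/=; congr (_ * (_ * _ ^+ k _)).
exact: val_inj.
Qed.

Lemma mdeg2 (k : multinom 2) : mdeg k = (k ord0 + k ord_max)%N.
Proof.
rewrite mdegE !big_ord_recl big_ord0 addn0.
by rewrite (_ : lift ord0 ord0 = ord_max)//; exact: val_inj.
Qed.

Lemma polyfun_ind (P : (R * R -> R) -> Prop) d :
  P (fun=> 0) -> (forall c f g, P f -> P g -> P (fun z => c * f z + g z)) ->
  (forall i j, (i + j < d)%N -> P (fun z => z.1 ^+ i * z.2 ^+ j)) ->
  forall f, polyfun d f -> P f.
Proof.
move=> P0 Plin Pmon _ [q sq ->].
rewrite eval2E.
have : {subset msupp q <= msupp q} by [].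
elim: {1 3}(msupp q : seq _) => [|k s IH] sk.
  by move: P0; congr P; apply/funext => z; rewrite big_nil.
have -> : (fun z : R * R => \sum_(k0 <- (k :: s)) mcoeff k0 q * (z.1 ^+ k0 ord0 * z.2 ^+ k0 ord_max)) =
   fun z => mcoeff k q * (z.1 ^+ k ord0 * z.2 ^+ k ord_max) +
      \sum_(k <- s) mcoeff k q * (z.1 ^+ k ord0 * z.2 ^+ k ord_max).
  by apply/funext => z; rewrite big_cons.
apply: Plin; last by apply: IH => x xs; apply: sk; rewrite inE xs orbT.
apply: Pmon; have /msize_mdeg_lt : k \in msupp q by apply: sk; rewrite mem_head.
move=> h; apply: leq_trans sq; apply: leq_ltn_trans h.
by rewrite mdeg2.
Qed.

Lemma polyfun_comp d f u v : polyfun d f -> polyfun 2 u -> polyfun 2 v ->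
  polyfun d (fun z => f (u z, v z)).
Proof.
move=> bf bu bv; move: f bf.
apply: (@polyfun_ind (fun f => polyfun d (fun z => f (u z, v z)))).
- exact: polyfun0.
- by move=> c f g bf bg; apply: polyfunD => //; exact: polyfunZ.
- by move=> i j ij /=; apply: polyfun_le ij _; rewrite -addnS; apply: polyfunM; exact: polyfunX.
Qed.

Lemma polyfun_affine (a b c : R) : polyfun 2 (fun z => a + b * z.1 + c * z.2).
Proof.
apply: polyfunD; last by apply: polyfunZ; exact: polyfun_snd.
by apply: polyfunD; [exact: polyfun_le (polyfun_cst a)|apply: polyfunZ; exact: polyfun_fst].
Qed.

Lemma polyfun_decomp d f : polyfun d.+1 f ->
  exists (u : {poly R}) g, [/\ (size u <= d.+1)%N, polyfun d g &
    forall z, f z = u.[z.2] + z.1 * g z].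
Proof.
move: f; apply: polyfun_ind.
- exists 0, (fun=> 0); split; [by rewrite size_poly0|exact: polyfun0|].
  by move=> z; rewrite horner0 mulr0 addr0.
- move=> c f1 f2 [u1 [g1 [s1 b1 e1]]] [u2 [g2 [s2 b2 e2]]].
  exists (c *: u1 + u2), (fun z => c * g1 z + g2 z); split.
  + by rewrite (leq_trans (size_polyD _ _))// geq_max s2 (leq_trans (size_scale_leq _ _)).
  + by apply: polyfunD => //; exact: polyfunZ.
  + by move=> z; rewrite e1 e2 hornerD hornerZ; ring.
- move=> [|i] j ij.
    exists 'X^j, (fun=> 0); split; [by rewrite size_polyXn|exact: polyfun0|].
    by move=> z; rewrite hornerXn mulr0 addr0 mul1r.
  exists 0, (fun z => z.1 ^+ i * z.2 ^+ j); split.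
  + by rewrite size_poly0.
  + apply: (@polyfun_le (i + j).+1); first by rewrite -ltnS -addSn.
    by rewrite -addnS; apply: polyfunM; apply: polyfunX; [exact: polyfun_fst|exact: polyfun_snd].
  + by move=> z; rewrite horner0 add0r exprS mulrA.
Qed.

(** Induction on [d], removing the nodes on the line [x = 0]. There [f] is a univariate polynomial
    with more roots than its degree, so that [f = x * g]. On the remaining nodes [x] is nonzero,
    hence [g] translated by [h] vanishes on the node triangle of the next smaller size. *)
Lemma polyfun_unisolvent (h : R) d f : h != 0 -> polyfun d f ->
  (forall i j, (i + j < d)%N -> f (i%:R * h, j%:R * h) = 0) -> forall z, f z = 0.
Proof.
move=> h0; elim: d f => [|d IH] f bf f0 z.
  case: bf => q; rewrite leqn0 msize_poly_eq0 => /eqP -> ->.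
  by rewrite /eval2 meval0.
have [u [g [su bg fE]]] := polyfun_decomp bf.
have u0 : u = 0.
  pose rs := [seq j%:R * h | j <- iota 0 d.+1].
  apply: (@roots_geq_poly_eq0 _ u rs); last by rewrite size_map size_iota.
    apply/allP => _ /mapP[j + ->]; rewrite mem_iota add0n => /andP[_ jd].
    have := f0 0%N j jd; rewrite fE/= mul0r mul0r addr0 => /eqP.
    by rewrite /root.
  rewrite map_inj_uniq ?iota_uniq// => i j /(mulIf h0)/eqP.
  by rewrite eqr_nat => /eqP.
have fE' z' : f z' = z'.1 * g z' by rewrite fE u0 horner0 add0r.
have bg' : polyfun d (fun z => g (z.1 + h, z.2)).
  apply: polyfun_comp => //; last exact: polyfun_snd.
  by apply: polyfunD; [exact: polyfun_fst|exact: polyfun_le (polyfun_cst h)].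
have g0 : forall z', g (z'.1 + h, z'.2) = 0.
  apply: IH bg' _ => i j ij /=.
  have := f0 i.+1 j; rewrite addSn ltnS => /(_ ij); rewrite fE' /= => /eqP.
  rewrite mulf_eq0 mulf_eq0 pnatr_eq0 (negPf h0)/= => /eqP.
  by rewrite -natr1 mulrDl mul1r.
have := g0 (z.1 - h, z.2); rewrite /= subrK -surjective_pairing => gz.
by rewrite fE' gz mulr0.
Qed.

(* As [polyfun d] means degree less than [d], this says that [f] and [g] have
   degree at most [d] and the same homogeneous part of degree [d]. *)
Definition sametop d f g := polyfun d.+1 g /\ polyfun d (fun z => f z - g z).

Lemma sametopM d e f f' g g' : sametop d f f' -> sametop e g g' ->
  sametop (d + e) (fun z => f z * g z) (fun z => f' z * g' z).
Proof.
move=> [bf bff] [bg bgg]; split; first by rewrite -addnS; exact: polyfunM.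
have bg1 : polyfun e.+1 g.
  have := polyfunD (polyfun_le (leqnSn _) bgg) bg.
  by congr polyfun; apply/funext => z; rewrite subrK.
have H := polyfunM bg1 bff; rewrite addnC in H; have := polyfunD (polyfunM bf bgg) H.
by congr polyfun; apply/funext => z; ring.
Qed.

Lemma sametop_sum d n (F G : 'I_n -> R * R -> R) : (forall i, sametop d (F i) (G i)) ->
  sametop d (fun z => \sum_i F i z) (fun z => \sum_i G i z).
Proof.
move=> h; split; first by apply: polyfun_sum => i; case: (h i).
have := polyfun_sum (fun i => (h i).2).
by congr polyfun; apply/funext => z; rewrite sumrB.
Qed.

Lemma sametopZ d c f g : sametop d f g -> sametop d (fun z => c * f z) (fun z => c * g z).
Proof.
move=> [bg bfg]; split; first exact: polyfunZ.
by have := polyfunZ c bfg; congr polyfun; apply/funext => z; rewrite mulrBr.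
Qed.

Lemma sametop_shift f c : polyfun 2 f -> sametop 1 (fun z => f z + c) f.
Proof.
move=> bf; split => //; have := polyfun_cst c.
by congr polyfun; apply/funext => z; rewrite addrAC subrr add0r.
Qed.

Lemma sametop_prod k (F : 'I_k -> R * R -> R) g : (forall i, sametop 1 (F i) g) ->
  sametop k (fun z => \prod_i F i z) (fun z => g z ^+ k).
Proof.
elim: k F => [|k IH] F h.
  split; first by have := polyfun_cst 1; congr polyfun; apply/funext => z; rewrite expr0.
  by have := polyfun0 0; congr polyfun; apply/funext => z; rewrite big_ord0 expr0 subrr.
have := sametopM (h ord0) (IH (fun i => F (lift ord0 i)) (fun i => h _)); rewrite add1n.
congr sametop; first by apply/funext => z; rewrite big_ord_recl.
by apply/funext => z; rewrite exprS.
Qed.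

Lemma sametopX k f g : sametop 1 f g -> sametop k (fun z => f z ^+ k) (fun z => g z ^+ k).
Proof.
move=> fg; have := @sametop_prod k (fun=> f) g (fun=> fg).
by congr sametop; apply/funext => z; rewrite prodr_const card_ord.
Qed.

End PolynomialFunctions.

(** * Lagrange interpolation of forms *)

Section InterpolationError.
Local Open Scope classical_set_scope.
Local Open Scope ring_scope.
Variables (R : realType) (m : nat).
Hypothesis hm : (2 <= m)%N.
Implicit Types (z w p e f : R * R) (b : nat -> R).

Let h : R := m.-1%:R^-1.

Lemma natr_pred_gt0 : 0 < m.-1%:R :> R.
Proof. by rewrite ltr0n; move: hm; case: m => // -[]. Qed.

Let h_gt0 : 0 < h. Proof. by rewrite invr_gt0 natr_pred_gt0. Qed.

(** The powers of each monomial are replaced by products of factors vanishing at 0, [h], [2 * h],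
    ...: the leading part is kept and the result is 0 at all nodes, which makes it the interpolation
    error of the form on the standard triangle. *)
Definition node_error b z : R :=
  \sum_(i < m.+1) b i * (\prod_(s < i) (z.1 - s%:R * h)) *
                        (\prod_(s < m - i) (z.2 - s%:R * h)).

Lemma node_error_node b (k l : nat) : (k + l < m)%N ->
  node_error b (k%:R * h, l%:R * h) = 0.
Proof.
move=> kl; rewrite /node_error big1// => i _.
(* [k >= i] and [l >= m - i] together would contradict [k + l < m], so one of the two products
   contains a zero factor. *)
have [ki|ik] := ltnP k i.
  by rewrite (bigD1 (Ordinal ki))//= subrr mul0r mulr0 mul0r.
have li : (l < m - i)%N by rewrite ltn_subRL; lia.
by rewrite [X in _ * X](bigD1 (Ordinal li))//= subrr mul0r mulr0.
Qed.

Lemma sametop_node_error b : sametop m (node_error b) (fun z => form_eval m b z.1 z.2).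
Proof.
have fact1 s : sametop 1 (fun z : R * R => z.1 - s%:R * h) fst.
  by apply: sametop_shift; exact: polyfun_fst.
have fact2 s : sametop 1 (fun z : R * R => z.2 - s%:R * h) snd.
  by apply: sametop_shift; exact: polyfun_snd.
apply: (sametop_sum (F := fun i z => b i * (\prod_(s < i) (z.1 - s%:R * h)) *
                        (\prod_(s < m - i) (z.2 - s%:R * h)))
    (G := fun i z => b i * z.1 ^+ i * z.2 ^+ (m - i))) => i.
have := sametopM (sametopZ (b i) (sametop_prod (k := i) (fun s => fact1 s)))
             (sametop_prod (k := m - i) (fun s => fact2 s)).
by rewrite subnKC// -ltnS.
Qed.

(** Each node factor is a difference of two numbers of [0, 1]: the coordinates lie there, and so
    does [s%:R * h] for [s < m], since [h] is the inverse of [m - 1]. *)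
Lemma node_error_le b z : stdtri z ->
  `|node_error b z| <= \sum_(i < m.+1) `|b i|.
Proof.
case: z => x y [/= x0 y0 xy].
have factored_le1 (u : R) (s : nat) : 0 <= u <= 1 -> (s < m)%N -> `|u - s%:R * h| <= 1.
  move=> /andP[u0 u1] sm.
  have s1 : s%:R * h <= 1.
    by rewrite /h ler_pdivrMr ?natr_pred_gt0// mul1r ler_nat; lia.
  have s0 : 0 <= s%:R * h by rewrite mulr_ge0// ltW.
  by move: s0 s1; rewrite ler_norml; set t := _ * h => ? ?; apply/andP; split; lra.
have prod_le1 (u : R) k : 0 <= u <= 1 -> (k <= m)%N -> `|\prod_(s < k) (u - s%:R * h)| <= 1.
  move=> u01 km; rewrite normr_prod.
  by apply: prodr_ile1 => s _; rewrite normr_ge0 factored_le1// (leq_trans (ltn_ord s)).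
apply: le_trans (ler_norm_sum _ _ _) _; apply: ler_sum => i _.
have im : (i <= m)%N by rewrite -ltnS.
rewrite !normrM -mulrA; apply: ler_piMr => //; apply: mulr_ile1 => //.
  by apply: prod_le1 => //=; apply/andP; split; lra.
by apply: prod_le1 => /=; [apply/andP; split; lra|exact: leq_subr].
Qed.

Lemma lagrange_node_aff (T : 'I_3 -> R * R) z : lagrange_node m T z <->
  exists k l : nat, (k + l < m)%N /\
    z = aff (T ord0) (side1 T) (side2 T) (k%:R * h, l%:R * h).
Proof.
have m0 := natr_pred_gt0.
split=> [[c [ck c1 ->]]|[k [l [kl ->]]]].
  rewrite bary_point_aff//.
  have [k _ ckE] := ck (lift ord0 ord0).
  have [l _ clE] := ck (lift ord0 (lift ord0 ord0)).
  have [j _ cjE] := ck ord0.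
  exists k, l; rewrite ckE clE; split => //.
  move: c1; rewrite sum_ord3 cjE ckE clE -!mulrDl => /(congr1 (fun u => u * m.-1%:R)).
  rewrite divfK ?gt_eqF// mul1r -!natrD => /eqP; rewrite eqr_nat => /eqP.
  by lia.
exists (bary3 (k%:R * h) (l%:R * h)); split; last first.
- by rewrite (bary_point_aff _ (sum_bary3 _ _)).
- exact: sum_bary3.
move=> i; rewrite /bary3; case: ifP => _; last by case: ifP => _; [exists k|exists l] => //; lia.
exists (m.-1 - k - l)%N; first by lia.
rewrite !natrB; [|lia|lia].
by rewrite /h; field; exact: lt0r_neq0.
Qed.

Lemma sametop_affine b p e f :
  sametop m (fun z => form_eval m b (aff p e f z).1 (aff p e f z).2)
        (fun z => form_eval m b (lineval (e.1, f.1) z.1 z.2) (lineval (e.2, f.2) z.1 z.2)).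
Proof.
have lin (u v c : R) : sametop 1 (fun z : R * R => c + u * z.1 + v * z.2) (fun z => lineval (u, v) z.1 z.2).
  have bl : polyfun 2 (fun z : R * R => lineval (u, v) z.1 z.2).
    by have := polyfun_affine 0 u v; congr polyfun; apply/funext => z; rewrite add0r.
  have := sametop_shift c bl; congr sametop; apply/funext => z.
  by rewrite /lineval/=; ring.
apply: (sametop_sum (F := fun i z => b i * (aff p e f z).1 ^+ i * (aff p e f z).2 ^+ (m - i))
   (G := fun i z => b i * lineval (e.1, f.1) z.1 z.2 ^+ i * lineval (e.2, f.2) z.1 z.2 ^+ (m - i))) => i.
have := sametopM (sametopZ (b i) (sametopX i (lin e.1 f.1 p.1))) (sametopX (m - i) (lin e.2 f.2 p.2)).
by rewrite subnKC// -ltnS.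
Qed.

(** The form minus its [node_error], carried over to [T], is an interpolant; hence [xget] does not
    return its default value, and unisolvence identifies what it returns. *)
Lemma interp_errorE (T : 'I_3 -> R * R) (v : R * R -> R) b :
  bracket (side1 T) (side2 T) != 0 ->
  (forall w, v (aff (T ord0) (side1 T) (side2 T) w) = form_eval m b w.1 w.2) ->
  forall w, let z := aff (T ord0) (side1 T) (side2 T) w in
    v z - eval2 (interp m T v) z = node_error b w.
Proof.
move=> D0 vE w /=.
set phi := aff _ _ _; set psi := aff_inv (T ord0) (side1 T) (side2 T).
have [_ bE] := sametop_node_error b.
have bphi d g : polyfun d g -> polyfun d (fun z => g (phi z)).
  by move=> bg; apply: (polyfun_comp bg); exact: polyfun_affine.
have bpsi d g : polyfun d g -> polyfun d (fun z => g (psi z)).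
  move=> bg; have -> : psi = aff (aff_inv_param (T ord0) (side1 T) (side2 T)).1.1
      (aff_inv_param (T ord0) (side1 T) (side2 T)).1.2
      (aff_inv_param (T ord0) (side1 T) (side2 T)).2 by apply/funext => z; exact: aff_invE.
  by apply: (polyfun_comp bg); exact: polyfun_affine.
have [q sq qE] := polyfunZ (-1) (bpsi _ _ bE).
have qI : interpolant m T v q.
  split => // z; rewrite inE => /lagrange_node_aff[k [l [kl ->]]].
  by rewrite -qE vE /psi affK// node_error_node// sub0r mulN1r opprK.
have [sI nI] : interpolant m T v (interp m T v) by exact: (xgetPex 0 (ex_intro _ q qI)).
have : node_error b w - form_eval m b w.1 w.2 + eval2 (interp m T v) (phi w) = 0.
  move: w; apply: (polyfun_unisolvent (h := h) (d := m)
    (f := fun w => node_error b w - form_eval m b w.1 w.2 + eval2 (interp m T v) (phi w))).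
  - by rewrite gt_eqF.
  - by apply: polyfunD => //; apply: bphi; exists (interp m T v).
  move=> k l kl; rewrite node_error_node//.
  have -> : eval2 (interp m T v) (phi (k%:R * h, l%:R * h)) = v (phi (k%:R * h, l%:R * h)).
    by apply: nI; rewrite inE; apply/lagrange_node_aff; exists k, l.
  by rewrite vE sub0r addNr.
by rewrite vE => H; apply/eqP; rewrite -subr_eq0 -oppr_eq0 -[X in _ == X]H; apply/eqP; ring.
Qed.

End InterpolationError.

(** * Finite differences in two variables *)

Section FiniteDifferences.
Local Open Scope classical_set_scope.
Local Open Scope ring_scope.
Variables (R : realType) (h : R).
Implicit Types (u v : R -> R) (f g : R * R -> R) (z : R * R) (c B : R).

Definition fdiff u x : R := u (x + h) - u x.
Definition fdiffx f z : R := f (z.1 + h, z.2) - f z.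
Definition fdiffy f z : R := f (z.1, z.2 + h) - f z.

Lemma fdiffxE f z : fdiffx f z = f (z.1 + h, z.2) - f z. Proof. by []. Qed.

Lemma fdiffyE f z : fdiffy f z = f (z.1, z.2 + h) - f z. Proof. by []. Qed.

Lemma iter_fdiff_lin n i (c : 'I_n -> R) (u : 'I_n -> R -> R) :
  iter i fdiff (fun x => \sum_k c k * u k x) = fun x => \sum_k c k * iter i fdiff (u k) x.
Proof.
elim: i => // i IH; rewrite iterS IH; apply/funext => x.
by rewrite /fdiff -sumrB; apply: eq_bigr => k _; rewrite -mulrBr.
Qed.

(** By the binomial formula one difference turns [x ^ p] into a combination of lower powers with
    leading coefficient [p * h]; after [i] differences only the leading term of the case [p = i] can
    survive. *)
Lemma iter_fdiff_expr i p : (p <= i)%N ->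
  iter i fdiff (fun x => x ^+ p) = fun=> (p == i)%:R * (i`!%:R * h ^+ i).
Proof.
elim: i p => [|i IH] p pi.
  by move: pi; rewrite leqn0 => /eqP ->; apply/funext => x /=; rewrite fact0 !expr0 !mulr1.
rewrite iterSr.
have -> : fdiff (fun x => x ^+ p) = fun x => \sum_(k < p) ('C(p, k)%:R * h ^+ (p - k)) * x ^+ k.
  apply/funext => x; rewrite /fdiff [x + h]addrC exprDn big_ord_recr/= subnn binn expr0 mulr1n mul1r addrK.
  by apply: eq_bigr => k _; rewrite -mulr_natl mulrA.
rewrite iter_fdiff_lin; apply/funext => x.
have E (k : 'I_p) : iter i fdiff (fun x => x ^+ k) x = (k == i :> nat)%:R * (i`!%:R * h ^+ i).
  by rewrite IH// -ltnS (leq_trans (ltn_ord k)).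
under eq_bigr do rewrite E.
have [pi1|pi1] := eqVneq p i.+1; last first.
  rewrite mul0r big1// => k _; rewrite ltn_eqF ?mul0r ?mulr0//.
  by have := ltn_ord k; lia.
rewrite pi1 in E *; rewrite big_ord_recr/= big1 ?add0r => [|k _]; last first.
  by rewrite ltn_eqF ?mul0r ?mulr0.
rewrite eqxx !mul1r subSnn expr1 binSn factS natrM exprS; ring.
Qed.

Lemma iter_fdiffx_prod i u v :
  iter i fdiffx (fun z => u z.1 * v z.2) = fun z => iter i fdiff u z.1 * v z.2.
Proof.
by elim: i => // i IH; rewrite iterS IH; apply/funext => z; rewrite /fdiffx/= -mulrBl.
Qed.

Lemma iter_fdiffy_prod i u v :
  iter i fdiffy (fun z => u z.1 * v z.2) = fun z => u z.1 * iter i fdiff v z.2.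
Proof.
by elim: i => // i IH; rewrite iterS IH; apply/funext => z; rewrite /fdiffy/= -mulrBr.
Qed.

Definition fdiffxy i j f := iter i fdiffx (iter j fdiffy f).

Lemma fdiffxy_lin i j c f g :
  fdiffxy i j (fun z => c * f z + g z) = fun z => c * fdiffxy i j f z + fdiffxy i j g z.
Proof.
rewrite /fdiffxy.
have -> : iter j fdiffy (fun z => c * f z + g z) = fun z => c * iter j fdiffy f z + iter j fdiffy g z.
  by elim: j => // j IH; rewrite iterS IH; apply/funext => z; rewrite !iterS !fdiffyE; ring.
elim: i => // i IH; rewrite iterS IH; apply/funext => z.
by rewrite !iterS !fdiffxE; ring.
Qed.

Lemma fdiffxy0 i j : fdiffxy i j (fun=> 0) = fun=> 0.
Proof.
rewrite /fdiffxy (_ : iter j fdiffy _ = fun=> 0).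
  by elim: i => // i IH; rewrite iterS IH; apply/funext => z; rewrite /fdiffx subrr.
by elim: j => // j IH; rewrite iterS IH; apply/funext => z; rewrite /fdiffy subrr.
Qed.

Lemma fdiffxy_mono i j p q : (p + q <= i + j)%N ->
  fdiffxy i j (fun z => z.1 ^+ p * z.2 ^+ q) =
  fun=> ((p == i) && (q == j))%:R * (i`!%:R * j`!%:R * h ^+ (i + j)).
Proof.
move=> pq; rewrite /fdiffxy (iter_fdiffy_prod j (fun x => x ^+ p) (fun x => x ^+ q)).
rewrite (iter_fdiffx_prod i (fun x => x ^+ p)); apply/funext => z.
have [pi|pi] := ltnP p i.
  by rewrite iter_fdiff_expr 1?ltnW// (ltn_eqF pi) !mul0r.
have qj : (q <= j)%N by lia.
rewrite (iter_fdiff_expr qj).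
have [qE|qj'] := eqVneq q j; last by rewrite andbF !mul0r mulr0.
have -> : p = i by lia.
by rewrite iter_fdiff_expr// eqxx/= !mul1r exprD; ring.
Qed.

Lemma fdiffxy_polyfun i j f z : polyfun (i + j) f -> fdiffxy i j f z = 0.
Proof.
move: f; apply: polyfun_ind.
- by rewrite fdiffxy0.
- by move=> c f g f0 g0; rewrite fdiffxy_lin f0 g0 mulr0 addr0.
- move=> p q pq; rewrite fdiffxy_mono ?(ltnW pq)//.
  by rewrite (_ : (p == i) && (q == j) = false) ?mul0r//; lia.
Qed.

(** Only the monomial with exponents [i] and [j] survives. Together with [fdiffxy_polyfun] this
    reads off a coefficient of the leading part of any polynomial of degree [i + j]. *)
Lemma fdiffxy_form_eval i j (b : nat -> R) z :
  fdiffxy i j (fun z => form_eval (i + j) b z.1 z.2) z = b i * (i`!%:R * j`!%:R * h ^+ (i + j)).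
Proof.
have H n (c : 'I_n -> R) (F : 'I_n -> R * R -> R) :
    fdiffxy i j (fun z => \sum_k c k * F k z) z = \sum_k c k * fdiffxy i j (F k) z.
  elim: n c F => [|n IH] c F.
    rewrite big_ord0 (_ : (fun z => _) = fun=> 0) ?fdiffxy0//.
    by apply/funext => w; rewrite big_ord0.
  rewrite big_ord_recl -IH.
  transitivity (fdiffxy i j (fun z => c ord0 * F ord0 z +
      \sum_k c (lift ord0 k) * F (lift ord0 k) z) z); last by rewrite fdiffxy_lin.
  by congr fdiffxy; apply/funext => w; rewrite big_ord_recl.
transitivity (fdiffxy i j (fun z => \sum_(k < (i + j).+1) b k * (z.1 ^+ k * z.2 ^+ (i + j - k))) z).
  by congr fdiffxy; apply/funext => w; apply: eq_bigr => k _; rewrite mulrA.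
rewrite H.
have ij : (i < (i + j).+1)%N by rewrite ltnS leq_addr.
rewrite (bigD1 (Ordinal ij))//= big1 ?addr0 => [|k ki].
  by rewrite fdiffxy_mono; [rewrite addKn !eqxx mul1r|lia].
rewrite fdiffxy_mono; last by have := ltn_ord k; lia.
by move: ki; rewrite -val_eqE/= => /negPf ->; rewrite mul0r mulr0.
Qed.

Lemma fdiffxy_le i j f z B :
  (forall s t, (s <= i)%N -> (t <= j)%N -> `|f (z.1 + s%:R * h, z.2 + t%:R * h)| <= B) ->
  `|fdiffxy i j f z| <= 2 ^+ (i + j) * B.
Proof.
move=> hB; have step (a b C : R) : `|a| <= C -> `|b| <= C -> `|a - b| <= 2 * C.
  by move=> ha hb; apply: le_trans (ler_normB _ _) _; lra.
have hy x y j' : (forall t, (t <= j')%N -> `|f (x, y + t%:R * h)| <= B) ->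
    `|iter j' fdiffy f (x, y)| <= 2 ^+ j' * B.
  elim: j' y => [|j' IH] y hy.
    by have := hy 0%N (leqnn _); rewrite mul0r addr0 expr0 mul1r.
  rewrite iterS exprS -mulrA; apply: step; last by apply: IH => t tj; apply: hy; lia.
  apply: IH => t tj; have := hy t.+1 tj; rewrite -natr1 mulrDl mul1r.
  by rewrite -addrA [h + _]addrC.
have hx x y i' : (forall s, (s <= i')%N -> `|iter j fdiffy f (x + s%:R * h, y)| <= 2 ^+ j * B) ->
    `|iter i' fdiffx (iter j fdiffy f) (x, y)| <= 2 ^+ i' * (2 ^+ j * B).
  elim: i' x => [|i' IH] x hx.
    by have := hx 0%N (leqnn _); rewrite mul0r addr0 expr0 mul1r.
  rewrite iterS exprS -mulrA; apply: step; last by apply: IH => t tj; apply: hx; lia.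
  apply: IH => t tj; have := hx t.+1 tj; rewrite -natr1 mulrDl mul1r.
  by rewrite -addrA [h + _]addrC.
rewrite exprD -mulrA /fdiffxy [z]surjective_pairing; apply: hx => s si.
by apply: hy => t tj; exact: hB.
Qed.

End FiniteDifferences.

(** * Two-sided bounds for the interpolation error *)

Section LnormBounds.
Local Open Scope classical_set_scope.
Local Open Scope ring_scope.
Variables (d : measure_display) (T : measurableType d) (R : realType).
Variables (mu : {measure set T -> \bar R}) (g : T -> R).
Hypothesis mg : measurable_fun [set: T] g.

Let mgr (r : R) : measurable_fun [set: T] (fun x => (`|g x| `^ r)%:E).
Proof.
apply/measurable_EFinP; apply: (measurableT_comp (measurable_powR r)).
exact: measurableT_comp.
Qed.

Let LnormE (r : R) : (Lnorm mu r%:E (fun x => (g x)%:E) =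
  (\int[mu]_x (`|g x| `^ r)%:E) `^ r^-1)%E.
Proof. by rewrite unlock /Lnorm; under eq_integral do rewrite abse_EFin poweR_EFin. Qed.

(** The function lives on a set of measure 1, so that the supremum bounds the norm with a constant
    free of [p]. *)
Lemma Lnorm_le_sup (p : \bar R) (S : set T) (c : R) : (1 <= p)%E -> 0 <= c ->
  measurable S -> mu S = 1%E -> (forall x, S x -> `|g x| <= c) ->
  (forall x, ~ S x -> g x = 0) -> (Lnorm mu p (fun x => (g x)%:E) <= c%:E)%E.
Proof.
move=> p1 c0 mS S1 gc g0.
case: p p1 => [r|_|//]; last first.
  rewrite unlock /Lnorm; case: ifP => _; last by rewrite lee_fin.
  apply/ess_supP; apply: nearW => x; rewrite /= lee_fin.
  have [Sx|Sx] := pselect (S x); first exact: gc.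
  by rewrite g0// normr0.
rewrite lee_fin => r1.
have r0 : 0 < r by exact: lt_le_trans r1.
have I : (\int[mu]_x (`|g x| `^ r)%:E <= (c `^ r)%:E)%E.
  apply: (@le_trans _ _ (\int[mu]_x ((c `^ r)%:E * (\1_S x)%:E))%E).
    apply: ge0_le_integral => //.
      by apply: measurable_funeM; apply/measurable_EFinP; exact: measurable_indic.
    move=> x _; rewrite -EFinM lee_fin indicE.
    have [Sx|Sx] := pselect (S x).
      by rewrite mem_set// mulr1; apply: ge0_ler_powR; rewrite ?nnegrE ?(ltW r0)// gc.
    by rewrite memNset// mulr0 g0// normr0 powR0// gt_eqF.
  rewrite ge0_integralZl_EFin//; last 2 first.
  - by apply/measurable_EFinP; exact: measurable_indic.
  - exact: powR_ge0.
  by rewrite integral_indic// setIT [X in (_ * X)%E]S1 mule1.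
rewrite LnormE; apply: (@le_trans _ _ ((c `^ r)%:E `^ r^-1)%E).
  apply: gt0_ler_poweR => //; first by rewrite invr_ge0 ltW.
  - by rewrite in_itv/= leey andbT integral_ge0// => x _; rewrite lee_fin powR_ge0.
  - by rewrite in_itv/= leey andbT lee_fin powR_ge0.
by rewrite poweR_EFin -powRrM mulfV ?gt_eqF// powRr1.
Qed.

(** For finite [p] the norm is at least [c] times the [p]-th root of [s], and that root is at least
    [s] because [s <= 1]. For [p = +oo], an essential supremum below [c] would make [E]
    negligible. *)
Lemma Lnorm_ge_on (p : \bar R) (E : set T) (c s : R) : (1 <= p)%E -> 0 <= c ->
  0 < s <= 1 -> measurable E -> (s%:E <= mu E)%E -> (forall x, E x -> c <= `|g x|) ->
  ((c * s)%:E <= Lnorm mu p (fun x => (g x)%:E))%E.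
Proof.
move=> p1 c0 /andP[s0 s1] mE sE gc.
case: p p1 => [r|_|//]; last first.
  have E0 : (0 < mu E)%E by rewrite (lt_le_trans _ sE)// lte_fin.
  rewrite unlock /Lnorm ifT; last first.
    by rewrite (lt_le_trans E0)// le_measure ?inE//; exact: measurableT.
  apply: (@le_trans _ _ c%:E); first by rewrite lee_fin ler_piMr.
  rewrite leNgt; apply/negP => lt.
  have := ess_sup_ge mu (abse \o (fun x => (g x)%:E)).
  rewrite -/(almost_everywhere _ _) => -[N [mN N0 sub]].
  have : (mu E <= mu N)%E.
    apply: le_measure; rewrite ?inE// => x Ex; apply: sub => /= H.
    have := le_lt_trans H lt; rewrite lte_fin ltNge.
    by rewrite gc.
  by rewrite N0 leNgt E0.
rewrite lee_fin => r1.
have r0 : 0 < r by exact: lt_le_trans r1.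
have I : ((c `^ r * s)%:E <= \int[mu]_x (`|g x| `^ r)%:E)%E.
  apply: (@le_trans _ _ (\int[mu]_x ((c `^ r)%:E * (\1_E x)%:E))%E).
    rewrite ge0_integralZl_EFin//; last 2 first.
    - by apply/measurable_EFinP; exact: measurable_indic.
    - exact: powR_ge0.
    by rewrite integral_indic// setIT EFinM lee_wpmul2l// lee_fin powR_ge0.
  apply: ge0_le_integral => //.
  - by move=> x _; rewrite -EFinM lee_fin mulr_ge0// powR_ge0.
  - by apply: measurable_funeM; apply/measurable_EFinP; exact: measurable_indic.
  move=> x _; rewrite -EFinM lee_fin indicE.
  have [Ex|Ex] := pselect (E x).
    by rewrite mem_set// mulr1; apply: ge0_ler_powR; rewrite ?nnegrE ?(ltW r0)// gc.
  by rewrite memNset// mulr0 powR_ge0.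
rewrite LnormE; apply: (@le_trans _ _ ((c `^ r * s)%:E `^ r^-1)%E); last first.
  apply: gt0_ler_poweR => //; first by rewrite invr_ge0 ltW.
  - by rewrite in_itv/= leey andbT lee_fin mulr_ge0 ?powR_ge0// ltW.
  - by rewrite in_itv/= leey andbT integral_ge0// => x _; rewrite lee_fin powR_ge0.
rewrite poweR_EFin lee_fin powRM ?powR_ge0 ?(ltW s0)//.
rewrite -powRrM mulfV ?gt_eqF// powRr1//; apply: ler_wpM2l => //.
rewrite -[leLHS]powRr1 ?(ltW s0)//; apply: ger_powR; first by rewrite s0.
by rewrite invf_le1.
Qed.

End LnormBounds.

Definition sum_norm (R : realType) n (a : 'rV[R]_n) := \sum_i `|a 0 i|.

Section ErrorBounds.
Local Open Scope classical_set_scope.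
Local Open Scope ring_scope.
Variables (R : realType) (m : nat).
Hypothesis hm : (2 <= m)%N.
Local Notation RR := (measurableTypeR R).
Local Notation lambda := (@lebesgue_measure R).
Local Notation mu := (lambda \x lambda)%E.
Local Notation plane := (RR * RR)%type.
Implicit Types (a b : 'rV[R]_m.+1) (v : R * R -> R) (T : 'I_3 -> R * R).

Definition hform a z := form_eval m (fun i => (rVpoly a)`_i) z.1 z.2.

Lemma measurable_polyfun d (g : R * R -> R) : polyfun d g ->
  measurable_fun [set: plane] (g : plane -> RR).
Proof.
move: g; apply: polyfun_ind.
- exact: measurable_cst.
- move=> c f g mf mg; apply: (measurable_funD (f := fun z => c * f z)) => //.
  exact: measurable_funM.
- move=> i j _; apply: (measurable_funM (f := fun z : plane => z.1 ^+ i) (g := fun z : plane => z.2 ^+ j)).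
    by apply: measurable_funX; exact: measurable_fst.
  by apply: measurable_funX; exact: measurable_snd.
Qed.

Lemma polyfun_interp T v : polyfun m (eval2 (interp m T v)).
Proof.
exists (interp m T v) => //; rewrite /interp; case: xgetP => [q _ [sq _]|_] //.
by rewrite msize0.
Qed.

Lemma polyfun_hform a : polyfun m.+1 (hform a).
Proof. by case: (sametop_node_error m (fun i => (rVpoly a)`_i)). Qed.

Lemma measurable_tri T : bracket (side1 T) (side2 T) != 0 -> measurable (tri T : set plane).
Proof.
by move=> D0; rewrite tri_aff; apply: measurable_aff_image => //; exact: measurable_stdtri.
Qed.

Lemma measurable_error T a : bracket (side1 T) (side2 T) != 0 ->
  measurable_fun [set: plane]
   (fun z => (hform a z - eval2 (interp m T (hform a)) z) * \1_(tri T) z : RR).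
Proof.
move=> D0.
apply: (measurable_funM (f := fun z : plane => hform a z - eval2 (interp m T (hform a)) z)).
  apply: (@measurable_polyfun m.+1); apply: polyfunB; first exact: polyfun_hform.
  exact: polyfun_le (polyfun_interp _ _).
by apply: measurable_indic; exact: measurable_tri.
Qed.

Lemma hform_form_subst e f a w :
  hform (form_subst e f a) w = hform a (lineval (e.1, f.1) w.1 w.2, lineval (e.2, f.2) w.1 w.2).
Proof. by rewrite /hform rVpoly_form_subst form_eval_coef_substE. Qed.

(** With a vertex at the origin the form pulled back to the standard triangle is again homogeneous,
    namely [form_subst]. This is enough for the upper bound, where the triangle may be chosen. *)
Lemma interp_error_le T a p : (1 <= p)%E -> bracket (side1 T) (side2 T) != 0 ->
  area T = 1%E -> T ord0 = (0, 0) ->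
  (interp_error m p T (hform a) <= (sum_norm (form_subst (side1 T) (side2 T) a))%:E)%E.
Proof.
move=> p1 D0 aT T0; set b := form_subst _ _ a.
rewrite /interp_error.
apply: (@Lnorm_le_sup _ _ _ mu _ (measurable_error a D0) p (tri T)) => //.
- by apply: sumr_ge0.
- exact: measurable_tri.
- move=> z; rewrite /= tri_aff => -[w tw <-].
  rewrite indicE mem_set ?mulr1; last by exists w.
  rewrite (interp_errorE hm (b := fun i => (rVpoly b)`_i) D0).
    apply: le_trans (node_error_le hm _ tw) _.
    by rewrite /sum_norm; apply: ler_sum => i _; rewrite coef_rVpoly_ord.
  move=> {tw}w; rewrite -/(hform b w) hform_form_subst; congr hform.
  by rewrite T0 /aff /lineval/= !add0r.
- by move=> z Tz; rewrite indicE memNset// mulr0.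
Qed.

(** The step of the differences, not the distance of the nodes: at most [m] steps in total move a
    point by at most 1/2, so that the half-size triangle stays inside the standard one. *)
Let h : R := (2 * m)%:R^-1.
Let h_gt0 : 0 < h. Proof. by rewrite invr_gt0 ltr0n; lia. Qed.

(* [4 (m + 1)^2]: one half-size triangle, and [(m + 1)^2] translations. *)
Let s : R := (4 * m.+1 ^ 2)%:R^-1.

(** [h ^+ m] is the scale of a difference of order [m] and [2 ^+ m] its loss in size; the extra 1/2
    makes an argument by contradiction strict, and [s] is the measure of the set where the error is
    large. *)
Definition lower_cst : R := (h / 2) ^+ m / 2 * s.

Lemma lower_cst_gt0 : 0 < lower_cst.
Proof. by rewrite /lower_cst !mulr_gt0// ?exprn_gt0 ?divr_gt0// invr_gt0// ltr0n. Qed.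

(** The interpolant and the translation part only affect lower degrees, so that the difference of
    order [(i, m - i)] of the pulled-back error [er] is a constant multiple of [b 0 i]. Near every
    point [er] is therefore large at some grid point, and a covering argument bounds from below the
    measure of the set [E] where it is large. *)
Lemma interp_error_ge T a p i : (1 <= p)%E -> bracket (side1 T) (side2 T) != 0 ->
  area T = 1%E ->
  ((lower_cst * `|form_subst (side1 T) (side2 T) a 0 i|)%:E <= interp_error m p T (hform a))%E.
Proof.
move=> p1 D0 aT; set b := form_subst _ _ a.
pose phi := aff (T ord0) (side1 T) (side2 T).
pose er z := hform a (phi z) - eval2 (interp m T (hform a)) (phi z).
have bphi d g : polyfun d g -> polyfun d (fun z => g (phi z)).
  by move=> bg; apply: (polyfun_comp bg); exact: polyfun_affine.
have er_polyfun : polyfun m.+1 er.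
  apply: polyfunB; first by apply: bphi; exact: polyfun_hform.
  by apply: bphi; exact: polyfun_le (polyfun_interp _ _).
have im : (i <= m)%N by rewrite -ltnS.
have er_b : polyfun m (fun z => er z - hform b z).
  have [_ H] := sametop_affine m (fun i => (rVpoly a)`_i) (T ord0) (side1 T) (side2 T).
  have := polyfunB H (bphi _ _ (polyfun_interp T (hform a))).
  by congr polyfun; apply/funext => w; rewrite /er hform_form_subst /hform/=; ring.
have difb z : fdiffxy h i (m - i) er z = b 0 i * (i`!%:R * (m - i)`!%:R * h ^+ m).
  have -> : er = fun z => 1 * (er z - hform b z) + hform b z.
    by apply/funext => w; rewrite mul1r subrK.
  rewrite fdiffxy_lin mul1r fdiffxy_polyfun ?add0r; last by rewrite subnKC//; exact: er_b.
  have := fdiffxy_form_eval h i (m - i) (fun i => (rVpoly b)`_i) z.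
  by rewrite subnKC// coef_rVpoly_ord.
pose c := `|b 0 i| * ((h / 2) ^+ m / 2).
have c0 : 0 <= c by rewrite mulr_ge0// divr_ge0// exprn_ge0// divr_ge0// ltW.
have key z : exists s t, [/\ (s <= i)%N, (t <= m - i)%N & c <= `|er (z.1 + s%:R * h, z.2 + t%:R * h)|].
  apply: contrapT => H.
  have lt s' t' : (s' <= i)%N -> (t' <= m - i)%N -> `|er (z.1 + s'%:R * h, z.2 + t'%:R * h)| < c.
    by move=> si ti; rewrite ltNge; apply/negP => cl; apply: H; exists s', t'.
  have := fdiffxy_le (h := h) (fun s' t' si ti => ltW (lt s' t' si ti)).
  rewrite difb subnKC// !normrM !normr_nat.
  have hm0 : 0 < h ^+ m by rewrite exprn_gt0.
  rewrite (ger0_norm (ltW hm0)).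
  have E : 2 ^+ m * c = `|b 0 i| * h ^+ m / 2.
    by rewrite /c expr_div_n; field; rewrite expf_neq0.
  rewrite E => le1.
  have f1 : 1 <= i`!%:R * (m - i)`!%:R :> R by rewrite -natrM ler1n muln_gt0 !fact_gt0.
  have le2 : `|b 0 i| * h ^+ m <= `|b 0 i| * (i`!%:R * (m - i)`!%:R * h ^+ m).
    by rewrite ler_wpM2l// ler_peMl// ltW.
  have le3 := le_trans le2 le1.
  have bh0 : 0 <= `|b 0 i| * h ^+ m by rewrite mulr_ge0// ltW.
  (* The spare factor 1/2 leaves only [b 0 i = 0]; then [c = 0], and an absolute value would be less
     than 0. *)
  have bh : `|b 0 i| * h ^+ m = 0 by lra.
  have c00 : c = 0.
    by apply: (mulfI (_ : 2 ^+ m != 0)); rewrite ?expf_neq0// E bh mul0r mulr0.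
  by have := lt 0%N 0%N (leq0n _) (leq0n _); rewrite c00 ltNge normr_ge0.
pose E : set plane := @stdtri R `&` [set w | c <= `|er w|].
have mE : measurable E.
  apply: measurableI; first exact: measurable_stdtri.
  have mer := measurable_polyfun er_polyfun.
  have mner : measurable_fun [set: plane] (fun z => `|er z| : RR).
    exact: measurableT_comp mer.
  rewrite (_ : [set w | _] = [set: plane] `&` (fun z => `|er z|) @^-1` `[c, +oo[).
    exact: mner.
  by apply/seteqP; split => z /=; rewrite in_itv/= andbT; [|case].
have [alpha alpha0 muE] := mu_stdtri R.
have br1 : bracket (1, 0) (0, 1) != 0 :> R by rewrite /bracket/= mulr1 mul0r subr0 oner_eq0.
have br2 : bracket (2^-1, 0) (0, 2^-1) = 4^-1 :> R by rewrite /bracket/=; field.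
have br20 : bracket (2^-1, 0) (0, 2^-1) != 0 :> R by rewrite br2.
pose Z := aff (0, 0) (2^-1, 0) (0, 2^-1) @` @stdtri R.
have muZ : mu Z = (alpha / 4)%:E.
  rewrite mu_aff_image//; last exact: measurable_stdtri.
  by rewrite muE br2 ger0_norm// -EFinM mulrC.
(* The grid shifts by [s'] and [t'] steps, both at most [m], are numbered by
   [k = s' * m.+1 + t']. *)
pose tau (k : nat) : plane -> plane :=
  aff ((k %/ m.+1)%:R * h, (k %% m.+1)%:R * h) (1, 0) (0, 1).
have tauE k : rescales (tau k) 1.
  have := rescales_aff ((k %/ m.+1)%:R * h, (k %% m.+1)%:R * h) br1.
  by rewrite /bracket/= mulr1 mul0r subr0 normr1 invr1.
have mtau k : measurable (tau k @^-1` E).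
  by have [mt _] := tauE k; rewrite -[X in measurable X]setTI; exact: mt.
(* By [key], each point of the half-size triangle [Z] is moved into [E] by one of the shifts. *)
have Zsub : Z `<=` \big[setU/set0]_(k < m.+1 ^ 2) (tau k @^-1` E).
  move=> _ [[x y] [/= x0 y0 xy] <-].
  set z := aff _ _ _ _.
  have zE : z = (x / 2, y / 2) by rewrite /z /aff/=; congr (_, _); field.
  have [s' [t' [si ti cl]]] := key z.
  have sm : (s' < m.+1)%N by rewrite ltnS (leq_trans si).
  have tm : (t' < m.+1)%N by rewrite ltnS (leq_trans ti)// leq_subr.
  have stm : (s' + t' <= m)%N by rewrite -(subnKC im) leq_add.
  have kE : (s' * m.+1 + t' < m.+1 ^ 2)%N.
    rewrite -mulnn (@leq_trans (s'.+1 * m.+1)) ?leq_mul2r ?sm ?orbT//.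
    by rewrite mulSn addnC ltn_add2r.
  rewrite -(bigcup_mkord _ (fun k => tau k @^-1` E)).
  exists (s' * m.+1 + t')%N => //=.
  rewrite /tau divnMDl// (divn_small tm) addn0 modnMDl (modn_small tm).
  have -> : aff (s'%:R * h, t'%:R * h) (1, 0) (0, 1) z = (z.1 + s'%:R * h, z.2 + t'%:R * h).
    by rewrite /aff/=; congr (_, _); ring.
  split => //; rewrite zE /=.
  have st : (s'%:R + t'%:R) * h <= 2^-1.
    rewrite -natrD /h ler_pdivrMr ?ltr0n ?muln_gt0 ?(ltnW hm)//.
    by rewrite natrM mulrA mulVf// mul1r ler_nat.
  have s0 : 0 <= s'%:R * h by rewrite mulr_ge0// ltW.
  have t0 : 0 <= t'%:R * h by rewrite mulr_ge0// ltW.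
  move: st s0 t0; rewrite mulrDl; set u1 := _ * h; set u2 := _ * h => *.
  by split => /=; lra.
have le4 : ((alpha / 4)%:E <= (m.+1 ^ 2)%:R%:E * mu E)%E.
  rewrite -muZ; apply: (le_trans (_ : _ <= mu (\big[setU/set0]_(k < m.+1 ^ 2) (tau k @^-1` E)))%E).
    apply: le_measure; rewrite ?inE//.
    - by apply: measurable_aff_image => //; exact: measurable_stdtri.
    - exact: bigsetU_measurable.
  have B := @Boole_inequality _ _ _ mu (fun k => tau k @^-1` E) (m.+1 ^ 2) (fun k _ => mtau k).
  apply: (le_trans B).
  rewrite (eq_bigr (fun=> mu E)) => [|k _]; last first.
    by have [_ tk] := tauE k; apply: etrans (tk _ mE) _; rewrite mul1e.
  by rewrite mule_natl sumr_const card_ord.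
have det : `|bracket (side1 T) (side2 T)| * alpha = 1.
  by apply: EFin_inj; rewrite EFinM -muE -areaE.
have mphiE : measurable (phi @` E : set plane) by exact: measurable_aff_image.
have le5 : (s%:E <= mu (phi @` E))%E.
  rewrite mu_aff_image//.
  have alphaV : `|bracket (side1 T) (side2 T)| = alpha^-1.
    by apply: (mulIf (lt0r_neq0 alpha0)); rewrite det mulVf ?lt0r_neq0.
  rewrite alphaV.
  have muEfin : mu E \is a fin_num.
    rewrite ge0_fin_numE//; apply: (@le_lt_trans _ _ (mu (@stdtri R))).
      by apply: le_measure; rewrite ?inE//; [exact: measurable_stdtri|move=> z []].
    by rewrite muE ltry.
  move: le4; rewrite -(fineK muEfin) -!EFinM !lee_fin => le4.
  have n0 : 0 < (m.+1 ^ 2)%:R :> R by rewrite ltr0n expn_gt0.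
  have -> : s = alpha^-1 * (alpha / 4 / (m.+1 ^ 2)%:R).
    by rewrite /s natrM; field; rewrite !lt0r_neq0.
  by rewrite ler_pM2l ?invr_gt0// ler_pdivrMr// [leRHS]mulrC.
have s01 : 0 < s <= 1.
  rewrite /s invr_gt0 ltr0n muln_gt0 expn_gt0/= invf_le1 ?ler1n ?ltr0n muln_gt0 ?expn_gt0//.
have -> : lower_cst * `|b 0 i| = c * s by rewrite /lower_cst /c; ring.
rewrite /interp_error.
apply: (@Lnorm_ge_on _ _ _ mu _ (measurable_error a D0) p (phi @` E)) => //.
move=> _ [w [tw cw] <-]; rewrite indicE mem_set ?mulr1//.
by rewrite tri_aff; exists w.
Qed.

End ErrorBounds.

(** * Comparison with the invariant polynomial *)

Section HomogeneousPolynomials.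
Local Open Scope classical_set_scope.
Local Open Scope ring_scope.
Variables (R : realType) (n : nat).
Implicit Types (P : mpoly n R) (a : 'rV[R]_n).

Lemma meval_homogZ P r (t : R) a : homog r P ->
  meval ((t *: a) 0) P = t ^+ r * meval (a 0) P.
Proof.
move=> /dhomogP hP; rewrite !mevalE mulr_sumr !big_seq.
apply: eq_bigr => k kP; rewrite [RHS]mulrCA; congr (_ * _).
under eq_bigr do rewrite mxE exprMn.
by rewrite big_split/= -(hP k kP) /= mdegE expr_sum.
Qed.

Lemma meval_homog_le P r : homog r P -> exists2 C : R, 0 < C &
  forall a, `|meval (a 0) P| <= C * sum_norm a ^+ r.
Proof.
move=> /dhomogP hP; exists (\sum_(k <- msupp P) `|mcoeff k P| + 1).
  by rewrite ltr_wpDl// sumr_ge0.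
move=> a; apply: (@le_trans _ _ ((\sum_(k <- msupp P) `|mcoeff k P|) * sum_norm a ^+ r)); last first.
  by rewrite ler_wpM2r ?lerDl// exprn_ge0// sumr_ge0.
rewrite mevalE; apply: le_trans (ler_norm_sum _ _ _) _.
rewrite mulr_suml !big_seq; apply: ler_sum => k kP.
rewrite normrM ler_wpM2l// -(hP k kP) /= mdegE expr_sum normr_prod.
apply: ler_prod => i _; rewrite normr_ge0/= normrX.
by rewrite lerXn2r ?nnegrE ?sumr_ge0// /sum_norm (bigD1 i)//= lerDl sumr_ge0.
Qed.

Lemma continuous_sum_seq (T : topologicalType) (I : Type) (s : seq I) (F : I -> T -> R) :
  (forall i, continuous (F i)) -> continuous (fun x => \sum_(i <- s) F i x).
Proof.
move=> cF; elim: s => [|i s IH] x.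
  by under eq_fun do rewrite big_nil; exact: cst_continuous.
under eq_fun do rewrite big_cons.
by apply: (@continuousD _ _ _ (F i)); [exact: cF|exact: IH].
Qed.

Lemma continuous_prod_seq (T : topologicalType) (I : Type) (s : seq I) (F : I -> T -> R) :
  (forall i, continuous (F i)) -> continuous (fun x => \prod_(i <- s) F i x).
Proof.
move=> cF; elim: s => [|i s IH] x.
  by under eq_fun do rewrite big_nil; exact: cst_continuous.
under eq_fun do rewrite big_cons.
by apply: (@continuousM _ _ (F i)); [exact: cF|exact: IH].
Qed.

Lemma continuous_exp (T : topologicalType) (F : T -> R) k :
  continuous F -> continuous (fun x => F x ^+ k).
Proof.
move=> cF; have -> : (fun x => F x ^+ k) = fun x => \prod_(i : 'I_k) F x.
  by apply/funext => x; rewrite prodr_const card_ord.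
exact: continuous_prod_seq.
Qed.

Lemma continuous_meval P : continuous (fun a : 'rV[R]_n => meval (a 0) P).
Proof.
have -> : (fun a : 'rV[R]_n => meval (a 0) P) =
   fun a => \sum_(k <- msupp P) mcoeff k P * \prod_i a 0 i ^+ k i.
  by apply/funext => a; rewrite mevalE.
apply: continuous_sum_seq => k a.
apply: (@continuousM _ _ (fun=> mcoeff k P)); first exact: cst_continuous.
apply: continuous_prod_seq => i; apply: continuous_exp.
exact: coord_continuous.
Qed.

End HomogeneousPolynomials.

(** * Norms along orbits and almost minimal forms *)

Section SubstitutionNorm.
Local Open Scope classical_set_scope.
Local Open Scope ring_scope.
Variables (R : realType) (m : nat).
Implicit Types (a b : 'rV[R]_m.+1) (e f : R * R).

Lemma form_substE e f a i : form_subst e f a 0 i =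
  \sum_(k < m.+1) a 0 k * (linpoly (e.1, f.1) ^+ k * linpoly (e.2, f.2) ^+ (m - k))`_i.
Proof.
rewrite /form_subst mxE /coef_subst /form_eval coef_sum; apply: eq_bigr => k _.
by rewrite -mulrA coefCM coef_rVpoly_ord.
Qed.

Lemma form_substZ e f t a : form_subst e f (t *: a) = t *: form_subst e f a.
Proof.
apply/rowP => i; rewrite [RHS]mxE !form_substE mulr_sumr; apply: eq_bigr => k _.
by rewrite mxE mulrA.
Qed.

Lemma sum_norm_ge0 n (a : 'rV[R]_n) : 0 <= sum_norm a.
Proof. exact: sumr_ge0. Qed.

Lemma sum_normZ t a : sum_norm (t *: a) = `|t| * sum_norm a.
Proof. by rewrite /sum_norm mulr_sumr; apply: eq_bigr => i _; rewrite mxE normrM. Qed.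

Lemma form_subst_scale (t : R) e f a :
  form_subst (t * e.1, t * e.2) (t * f.1, t * f.2) a = t ^+ m *: form_subst e f a.
Proof.
apply/rowP => i; rewrite [RHS]mxE !form_substE mulr_sumr; apply: eq_bigr => k _.
have L (u v : R) : linpoly (t * u, t * v) = t *: linpoly (u, v).
  by rewrite /linpoly/= scalerDr scalerA -[t *: _]mul_polyC -polyCM.
rewrite /= !L !exprZn -scalerAl -scalerAr scalerA coefZ -exprD subnKC; last by rewrite -ltnS.
by rewrite mulrCA.
Qed.

Lemma continuous_sum_norm_form_subst e f : continuous (fun a => sum_norm (form_subst e f a)).
Proof.
apply: continuous_sum_seq => i a.
apply: (@continuous_comp _ _ _ (fun a => form_subst e f a 0 i) (fun x => `|x|)).
  have -> : (fun a => form_subst e f a 0 i) = fun a =>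
      \sum_(k < m.+1) a 0 k * (linpoly (e.1, f.1) ^+ k * linpoly (e.2, f.2) ^+ (m - k))`_i.
    by apply/funext => b; rewrite form_substE.
  apply: continuous_sum_seq => k b.
  apply: (@continuousM _ _ (fun b => b 0 k)); last exact: cst_continuous.
  exact: coord_continuous.
exact: norm_continuous.
Qed.

Lemma continuous_sum_norm : continuous (fun a => sum_norm a).
Proof.
apply: continuous_sum_seq => i a.
apply: (@continuous_comp _ _ _ (fun a => a 0 i) (fun x => `|x|)).
  exact: coord_continuous.
exact: norm_continuous.
Qed.

Lemma norm_le_sum_norm a : `|a| <= sum_norm a.
Proof.
have [->|a0] := eqVneq `|a| 0; first exact: sum_norm_ge0.
have [[i j] E] := mx_norm_neq0 a0; apply: (@le_trans _ _ `|a 0 j|).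
  by rewrite -[leLHS]/(mx_norm a) E /= ord1.
by rewrite /sum_norm (bigD1 j)//= lerDl sumr_ge0.
Qed.

(** Unit forms whose norm is at most twice that of every transform of determinant 1. The factor 2 is
    there because minimal forms may not exist in an orbit; the conditions are closed, which gives
    compactness. *)
Definition reduced : set 'rV[R]_m.+1 :=
  [set a | sum_norm a = 1] `&`
  \bigcap_(ef in [set ef : (R * R) * (R * R) | bracket ef.1 ef.2 = 1])
    [set a | 2^-1 <= sum_norm (form_subst ef.1 ef.2 a)].

Lemma compact_reduced : compact reduced.
Proof.
apply: bounded_closed_compact.
  exists 1; split; first exact: num_real.
  by move=> M M1 a [a1 _]; apply: (le_trans (norm_le_sum_norm a)); rewrite a1 ltW.
apply: closedI.
  have /continuous_closedP := continuous_sum_norm.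
  by move=> /(_ [set 1]); apply; exact: closed_eq.
apply: closed_bigI => -[e f] _.
have /continuous_closedP := continuous_sum_norm_form_subst (e := e) (f := f).
by move=> /(_ [set x | 2^-1 <= x]); apply; exact: closed_ge.
Qed.

End SubstitutionNorm.

Lemma root_le (R : realType) r (C u v : R) : (0 < r)%N -> 0 < C -> 0 <= u -> 0 <= v ->
  u <= C * v ^+ r -> u `^ r%:R^-1 <= C `^ r%:R^-1 * v.
Proof.
move=> r0 C0 u0 v0 uv.
have rn0 : (r%:R : R) != 0 by rewrite pnatr_eq0 -lt0n.
have -> : v = (v ^+ r) `^ r%:R^-1.
  by rewrite -powR_mulrn// -powRrM mulfV// powRr1.
rewrite -powRM ?exprn_ge0 ?(ltW C0)//.
by apply: ge0_ler_powR; rewrite ?nnegrE ?invr_ge0 ?mulr_ge0 ?exprn_ge0 ?(ltW C0).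
Qed.

Lemma le_root (R : realType) r (C u v : R) : (0 < r)%N -> 0 < C -> 0 <= u -> 0 <= v ->
  v ^+ r <= C * u -> v <= C `^ r%:R^-1 * u `^ r%:R^-1.
Proof.
move=> r0 C0 u0 v0 uv.
have rn0 : (r%:R : R) != 0 by rewrite pnatr_eq0 -lt0n.
rewrite -powRM ?(ltW C0)//.
have {1}-> : v = (v ^+ r) `^ r%:R^-1.
  by rewrite -powR_mulrn// -powRrM mulfV// powRr1.
by apply: ge0_ler_powR; rewrite ?nnegrE ?invr_ge0 ?mulr_ge0 ?exprn_ge0 ?(ltW C0).
Qed.

Section Comparison.
Local Open Scope classical_set_scope.
Local Open Scope ring_scope.
Variables (R : realType) (m : nat) (P : mpoly m.+1 R) (r D : nat).
Hypotheses (r0 : (0 < r)%N) (hP : homog r P).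
Hypothesis P_ge0 : forall a : 'rV[R]_m.+1, 0 <= meval (a 0) P.
Hypothesis P_form_subst : forall e f (a : 'rV[R]_m.+1),
  meval (form_subst e f a 0) P = bracket e f ^+ D * meval (a 0) P.
Hypothesis P_null : forall a : 'rV[R]_m.+1, a != 0 -> meval (a 0) P = 0 ->
  forall eps : R, 0 < eps -> exists e f, bracket e f = 1 /\
    forall i, `|form_subst e f a 0 i| <= eps.
Variable delta : R.
Hypothesis delta_gt0 : 0 < delta.
Implicit Types (a : 'rV[R]_m.+1) (e f : R * R).

Let K a := meval (a 0) P.

(** Invariance transfers the bound of a homogeneous polynomial by the norm from [a] to its
    transforms. The sign of the determinant disappears because [P] is nonnegative. *)
Lemma root_le_sum_norm : exists2 C : R, 0 < C & forall a e f,
  `|bracket e f| = delta -> K a `^ r%:R^-1 <= C * sum_norm (form_subst e f a).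
Proof.
have [C C0 CP] := meval_homog_le hP.
have dD0 : 0 < delta ^+ D by rewrite exprn_gt0.
have C'0 : 0 < C / delta ^+ D by rewrite divr_gt0.
exists ((C / delta ^+ D) `^ r%:R^-1); first by rewrite powR_gt0.
move=> a e f ef; apply: root_le => //; [exact: P_ge0|exact: sum_norm_ge0|].
have := CP (form_subst e f a); rewrite P_form_subst normrM normrX ef (ger0_norm (P_ge0 a)).
by rewrite mulrAC ler_pdivlMr// [delta ^+ D * _]mulrC.
Qed.

(** The minimum on the compact set is attained at some [b]. If it were 0, [P_null] would give a
    transform of [b] of norm at most 1/4, against the bound 1/2 for reduced forms. *)
Lemma reduced_lower : exists2 c : R, 0 < c & forall a, reduced a -> c <= K a.
Proof.
have [[a0 ra0]|none] := pselect (reduced (R := R) (m := m) !=set0); last first.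
  by exists 1 => // a ra; exfalso; apply: none; exists a.
have cK : {within reduced (R := R) (m := m), continuous (fun a : 'rV[R]_m.+1 => K a)}.
  by apply: continuous_subspaceT; exact: continuous_meval.
have [b] := compact_EVT_min (ex_intro _ a0 ra0) (@compact_reduced R m) cK.
rewrite inE => -[b1 bmin] Kmin.
exists (K b); last by move=> a ra; apply: Kmin; rewrite inE.
rewrite lt_neqAle P_ge0 andbT eq_sym; apply/eqP => Kb0.
have b0 : b != 0.
  apply/eqP => bz; have /eqP : sum_norm b = 1 by exact: b1.
  rewrite bz /sum_norm big1 => [|i _]; last by rewrite mxE normr0.
  by rewrite eq_sym oner_eq0.
have eps0 : 0 < (4 * m.+1%:R)^-1 :> R by rewrite invr_gt0 mulr_gt0 ?ltr0n.
have [e [f [ef le]]] := P_null b0 Kb0 eps0.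
have /= := bmin (e, f) ef; rewrite leNgt => /negP; apply.
apply: (@le_lt_trans _ _ (\sum_(i < m.+1) (4 * m.+1%:R)^-1)); first exact: ler_sum.
rewrite sumr_const card_ord.
have -> : (4 * m.+1%:R)^-1 *+ m.+1 = 4^-1 :> R.
  by rewrite -[LHS]mulr_natl invfM mulrCA mulfV ?pnatr_eq0// mulr1.
by rewrite ltf_pV2 ?posrE ?ltr0n// ltr_nat.
Qed.

(** Up to scaling, an almost minimal form of the orbit is reduced, and [reduced_lower] applies to
    it. The term [eta] covers orbits that come arbitrarily close to 0, which cannot be normalized in
    this way. *)
Lemma sum_norm_le_root : exists2 C : R, 0 < C & forall a (eta : R), 0 < eta ->
  exists e f, `|bracket e f| = delta /\ sum_norm (form_subst e f a) <= C * K a `^ r%:R^-1 + eta.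
Proof.
have [c c0 cK] := reduced_lower.
pose t := Num.sqrt delta.
have t0 : 0 < t by rewrite sqrtr_gt0.
have tm0 : 0 < t ^+ m by rewrite exprn_gt0.
have C0 : 0 < c^-1 `^ r%:R^-1 by rewrite powR_gt0 ?invr_gt0.
(* Multiplying both columns by the square root of [delta] passes from determinant 1 to [delta]. *)
suff H a eta : 0 < eta -> exists e f, bracket e f = 1 /\
    sum_norm (form_subst e f a) <= c^-1 `^ r%:R^-1 * K a `^ r%:R^-1 + eta.
  exists (t ^+ m * c^-1 `^ r%:R^-1); first by rewrite mulr_gt0.
  move=> a eta eta0; have [|e [f [ef le]]] := H a (eta / t ^+ m); first by rewrite divr_gt0.
  exists (t * e.1, t * e.2), (t * f.1, t * f.2); split.
    have -> : bracket (t * e.1, t * e.2) (t * f.1, t * f.2) = t ^+ 2 * bracket e f.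
      by rewrite /bracket/=; ring.
    by rewrite ef mulr1 sqr_sqrtr ?(ltW delta_gt0)// ger0_norm// ltW.
  rewrite form_subst_scale sum_normZ (ger0_norm (ltW tm0)).
  apply: le_trans (ler_wpM2l (ltW tm0) le) _.
  by rewrite mulrDr mulrA [X in _ + X]mulrC divfK ?gt_eqF.
move=> eta0.
have [[e [f [ef le]]]|none] := pselect (exists e f, bracket e f = 1 /\ sum_norm (form_subst e f a) <= eta).
  exists e, f; split => //; apply: le_trans le _.
  by rewrite lerDr mulr_ge0 ?powR_ge0.
have gt e f : bracket e f = 1 -> eta < sum_norm (form_subst e f a).
  by move=> ef; rewrite ltNge; apply/negP => le; apply: none; exists e, f.
pose V := [set x : R | exists e f, bracket e f = 1 /\ x = sum_norm (form_subst e f a)].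
have lbV : lbound V eta by move=> _ [e [f [ef ->]]]; rewrite ltW// gt.
have infV : has_inf V.
  split; last by exists eta.
  by exists (sum_norm (form_subst (1, 0) (0, 1) a)), (1, 0), (0, 1); rewrite /bracket/= mulr1 mul0r subr0.
have iota0 : 0 < inf V.
  by apply: lt_le_trans eta0 _; apply: lb_le_inf => //; case: infV.
(* The margin is [inf V] itself, positive by now, so that the norm found is less than twice the
   infimum. *)
have [_ [e [f [ef ->]]] lt] := inf_adherent iota0 infV.
set N0 := sum_norm _ in lt.
have N00 : 0 < N0 by apply: lt_trans eta0 _; exact: gt.
pose b := N0^-1 *: form_subst e f a.
have rb : reduced b.
  split.
    by rewrite /= sum_normZ ger0_norm ?invr_ge0 ?(ltW N00)// mulVf ?gt_eqF.
  move=> [e' f'] /= ef'.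
  rewrite /b form_substZ sum_normZ ger0_norm ?invr_ge0 ?(ltW N00)// form_subst_form_subst.
  rewrite mulrC ler_pdivlMr// mulrC ler_pdivrMr//.
  apply: (@le_trans _ _ (inf V * 2)); first by rewrite mulr_natr mulr2n ltW.
  rewrite ler_pM2r//; apply: ge_inf; first by exists eta.
  eexists; eexists; split; last reflexivity.
  rewrite -[RHS]mulr1 -{1}ef -ef' /bracket/=; ring.
exists e, f; split => //; apply: ler_wpDr; first exact: ltW.
apply: le_root => //; [by rewrite invr_gt0|exact: P_ge0|exact: ltW|].
have := cK b rb; rewrite /K /b (meval_homogZ _ _ hP) P_form_subst ef expr1n mul1r.
by rewrite exprVn ler_pdivlMl ?exprn_gt0// ler_pdivlMl// [c * _]mulrC.
Qed.

End Comparison.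

(** * Homogeneous polynomials and their coefficient vectors *)

Section Forms.
Local Open Scope classical_set_scope.
Local Open Scope ring_scope.
Variables (R : realType) (m : nat).
Implicit Types (a b : 'rV[R]_m.+1).

Lemma hformD a b z : hform (a + b) z = hform a z + hform b z.
Proof.
rewrite /hform /form_eval -big_split; apply: eq_bigr => i _ /=.
by rewrite linearD coefD -mulrA mulrDl !mulrA.
Qed.

Lemma hform_delta (c : R) (i : 'I_m.+1) z :
  hform (c *: delta_mx 0 i) z = c * z.1 ^+ i * z.2 ^+ (m - i).
Proof.
rewrite /hform /form_eval (bigD1 i)//= big1 ?addr0 => [|k ki].
  by rewrite coef_rVpoly_ord !mxE !eqxx mulr1.
by rewrite coef_rVpoly_ord !mxE (negPf ki) mulr0 !mul0r.
Qed.

Lemma homog_hform (q : mpoly 2 R) : homog m q -> exists a, eval2 q = hform a.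
Proof.
move=> /dhomogP hq.
have : {in msupp q, forall k, mdeg k = m} by exact: hq.
rewrite eval2E.
elim: (msupp q : seq _) => [|k s IH] sk.
  exists 0; apply/funext => z; rewrite big_nil /hform /form_eval big1// => i _.
  by rewrite linear0 coef0 !mul0r.
have [|a aE] := IH; first by move=> x xs; apply: sk; rewrite inE xs orbT.
have km : (k ord0 + k ord_max = m)%N.
  by rewrite -(sk k (mem_head _ _)) mdeg2.
have k0 : (k ord0 < m.+1)%N by rewrite ltnS -km leq_addr.
exists (mcoeff k q *: delta_mx 0 (Ordinal k0) + a); apply/funext => z.
have mk : (m - k ord0 = k ord_max)%N by rewrite -km addKn.
by rewrite hformD -aE big_cons hform_delta /= mk mulrA.
Qed.

Lemma hform_inj a b : hform a = hform b -> a = b.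
Proof.
move=> ab; apply/rowP => i.
have im : (i <= m)%N by rewrite -ltnS.
have H c := fdiffxy_form_eval (1 : R) i (m - i) (fun k => (rVpoly c)`_k) (0, 0).
have Ha := H _ a; have Hb := H _ b; rewrite !subnKC// !coef_rVpoly_ord in Ha Hb.
have : a 0 i * (i`!%:R * (m - i)`!%:R * 1 ^+ m) = b 0 i * (i`!%:R * (m - i)`!%:R * 1 ^+ m).
  by rewrite -Ha -Hb -[fun z => _]/(hform a) ab.
by apply: mulIf; rewrite expr1n mulr1 -natrM pnatr_eq0 -lt0n muln_gt0 !fact_gt0.
Qed.

Lemma eval2_form (a : 'I_m.+1 -> R) : eval2 (Defs.form a) = hform (\row_i a i).
Proof.
apply/funext => z; rewrite /eval2 /Defs.form /= /form_poly raddf_sum; apply: eq_bigr => i _.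
rewrite coef_rVpoly_ord mxE /= mevalZ mevalM !rmorphXn /mpX /= !mevalXU/=.
by rewrite mulrA.
Qed.

End Forms.

Section ShapeFunction.
Local Open Scope classical_set_scope.
Local Open Scope ring_scope.
Variables (R : realType) (m : nat).
Hypothesis hm : (2 <= m)%N.
Implicit Types (a : 'rV[R]_m.+1) (e f : R * R) (pi : hpoly R m) (p : \bar R).

(** The competitor is the triangle with vertices 0, [e], [f]; the determinant [alpha^-1] is the one
    that gives area 1. *)
Lemma shape_function_le a pi p e f alpha : eval2 pi = hform a ->
  (1 <= p)%E -> 0 < alpha -> ((@lebesgue_measure R \x @lebesgue_measure R) (@stdtri R) = alpha%:E)%E ->
  `|bracket e f| = alpha^-1 ->
  (shape_function p pi <= (sum_norm (form_subst e f a))%:E)%E.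
Proof.
move=> piE p1 alpha0 mt ef.
pose T (i : 'I_3) : R * R :=
  if i == ord0 then (0, 0) else if i == lift ord0 ord0 then e else f.
have s1 : side1 T = e by rewrite /side1 /T/= subr0.
have s2 : side2 T = f by rewrite /side2 /T/= subr0.
have D0 : bracket (side1 T) (side2 T) != 0.
  by rewrite s1 s2 -normr_eq0 ef invr_eq0 gt_eqF.
have aT : area T = 1%E.
  by rewrite areaE// mt s1 s2 ef -EFinM mulVf// gt_eqF.
have := interp_error_le hm a p1 D0 aT erefl; rewrite s1 s2.
apply: le_trans; apply: ereal_inf_lbound; exists T; last by rewrite piE.
by split => //; apply/nondegenerateP.
Qed.

Lemma shape_function_ge a pi p alpha (C : R) : eval2 pi = hform a ->
  (1 <= p)%E -> 0 < alpha -> ((@lebesgue_measure R \x @lebesgue_measure R) (@stdtri R) = alpha%:E)%E ->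
  (forall e f, `|bracket e f| = alpha^-1 -> C <= sum_norm (form_subst e f a)) ->
  ((lower_cst R m / m.+1%:R * C)%:E <= shape_function p pi)%E.
Proof.
move=> piE p1 alpha0 mt hC; apply: le_ereal_inf_tmp => _ [T [nT aT] <-].
have /nondegenerateP D0 := nT.
have DE : `|bracket (side1 T) (side2 T)| = alpha^-1.
  apply: (mulIf (lt0r_neq0 alpha0)); rewrite mulVf ?gt_eqF//.
  by apply: EFin_inj; rewrite EFinM -mt -areaE.
have le i := interp_error_ge hm a i p1 D0 aT.
rewrite piE.
(* The bounds on the single coefficients are summed over the [m.+1] indices, which explains the
   division; infinite values of the error are set aside beforehand. *)
case: (interp_error m p T (hform a)) le => [x|_|le]; last 2 first.
- exact: leey.
- by have := le ord0; rewrite leeNy_eq.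
move=> le; rewrite lee_fin.
have l0 := lower_cst_gt0 R hm.
apply: (@le_trans _ _ (lower_cst R m / m.+1%:R * sum_norm (form_subst (side1 T) (side2 T) a))).
  by rewrite ler_wpM2l ?hC// divr_ge0// ltW.
rewrite mulrAC ler_pdivrMr ?ltr0n// /sum_norm mulr_sumr.
apply: (@le_trans _ _ (\sum_(i < m.+1) x)).
  by apply: ler_sum => i _; have := le i; rewrite lee_fin.
by rewrite sumr_const card_ord mulr_natr.
Qed.

End ShapeFunction.

Theorem theorem5p1 (R : realType) (m : nat) (hm : (2 <= m)%N) :
  exists (K : hpoly R m -> R) (P : mpoly m.+1 R) (C : R),
    let r := total_degree P in
    [/\ polynomial_on_hpoly K P,
        (1 <= r)%N,
        forall pi : hpoly R m, 0 <= K pi,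
        0 < C &
        forall (pi : hpoly R m) (p : \bar R), (1 <= p)%E ->
          ((C^-1 * K pi `^ r%:R^-1)%:E <= shape_function p pi)%E /\
          (shape_function p pi <= (C * K pi `^ r%:R^-1)%:E)%E].
Proof.
have [P [r [D [[r0 hP] P0 P_ge0 P_form_subst P_null]]]] := form_invariant R hm.
have [alpha alpha0 mt] := mu_stdtri R.
have delta0 : 0 < alpha^-1 by rewrite invr_gt0.
have [C1 C10 le1] := root_le_sum_norm r0 hP P_ge0 P_form_subst delta0.
have [C2 C20 le2] := sum_norm_le_root r0 hP P_ge0 P_form_subst P_null delta0.
have coefs (pi : hpoly R m) : exists a : 'rV[R]_m.+1, eval2 pi = hform a.
  exact: homog_hform (dhomog_is_dhomog pi).
have [a aE] := choice coefs.
(* A nonzero homogeneous polynomial has its weight as degree, so the root taken in the statement is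
   the one for which the bounds were proved. *)
have rE : total_degree P = r.
  by apply: (dhomog_uniq P0 _ hP); exact: dhomog_msize hP.
have l0 := lower_cst_gt0 R hm.
pose C0 := C1 * m.+1%:R / lower_cst R m.
have C00 : 0 < C0 by rewrite divr_gt0// mulr_gt0// ltr0n.
exists (fun pi => meval (a pi 0) P), P, (Num.max C0 C2).
rewrite rE /=; split => //.
(* The coefficient vectors were obtained by choice; injectivity of [hform] shows that the vector
   chosen for [form b] is [b]. *)
- move=> b; have /hform_inj -> : hform (a (Defs.form b)) = hform (\row_i b i).
    by rewrite -aE eval2_form.
  by apply: meval_eq => i; rewrite mxE.
- by rewrite lt_max C00.
move=> pi p p1; set K := meval _ P `^ _.
have K0 : 0 <= K by exact: powR_ge0.
split.
  have hC e f : `|bracket e f| = alpha^-1 -> C1^-1 * K <= sum_norm (form_subst e f (a pi)).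
    by move=> ef; rewrite ler_pdivrMl//; exact: le1.
  apply: le_trans (shape_function_ge hm (aE pi) p1 alpha0 mt hC).
  rewrite lee_fin mulrA ler_wpM2r//.
  have -> : lower_cst R m / m.+1%:R * C1^-1 = C0^-1.
    by rewrite /C0 invf_div invfM mulrA mulrAC.
  by rewrite lef_pV2 ?posrE ?lt_max ?C00// le_max lexx.
(* The upper bound holds up to every positive [eta], since the optimal substitution may not
   exist. *)
apply/lee_addgt0Pr => eta eta0.
have [e [f [ef le]]] := le2 (a pi) eta eta0.
apply: le_trans (shape_function_le hm (aE pi) p1 alpha0 mt ef) _.
rewrite -EFinD lee_fin; apply: le_trans le _; rewrite lerD2r ler_wpM2r//.
by rewrite le_max lexx orbT.
Qed.
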